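(* Let $r\geqslant3$ and let $\mathcal A_1$ be the class of $r$th order linear ODEs in the first Arnold form $$x^{(r)}+a_{r-1}(t)x^{(r-1)}+\dots+a_1(t)x^{(1)}=b(t)$$ with arbitrary smooth functions $a_{r-1},\dots,a_1,b$ of $t$. The equivalence groupoid of $\mathcal A_1$ is constituted by the admissible transformations whose equations-sources exhaust the whole class $\mathcal A_1$ and whose transformational parts are of the form $$\tilde t=T(t),\quad \tilde x=\frac{x}{\psi_1(t)}+X_0(t),$$ where $T$ and $X_0$ are arbitrary smooth functions of $t$ with $T_t\ne0$, and $\psi_1=\psi_1(t)$ is a nonzero solution of the homogeneous equation associated with the corresponding equation-source.
   Context: The underlying field $\mathbb F$ is $\mathbb R$ or $\mathbb C$; all variables, functions and constants are real or complex, respectively. $x=x(t)$ is the unknown function, $x^{(k)}=d^kx/dt^k$; $T_t$ is the derivative of $T$. Everything is local: functions and transformations are smooth and considered on suitable open domains (in particular, $\psi_1$ is nonvanishing on the domain considered). A point transformation is a transformation $\tilde t=T(t,x)$, $\tilde x=X(t,x)$ with nonvanishing Jacobian $\partial(T,X)/\partial(t,x)$; it acts on ODEs via prolongation to derivatives. An admissible transformation of a class of ODEs is a triple $(\mathcal E,\tilde{\mathcal E},\mathcal T)$, where $\mathcal E$ (the equation-source) and $\tilde{\mathcal E}$ (the equation-target) are equations of the class and $\mathcal T$ (the transformational part) is a point transformation mapping $\mathcal E$ to $\tilde{\mathcal E}$. The equivalence groupoid of the class is the set of all its admissible transformations with composition. The homogeneous equation associated with a linear ODE is obtained by replacing its right-hand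 side $b$ by $0$. *)

(* Defs.v *)
(* MathComp-Analysis. *)
From HB Require Import structures.
From mathcomp Require Import all_boot all_order all_algebra.
From mathcomp Require Import all_classical all_reals all_analysis.
From mathcomp Require Export complex.

Set Implicit Arguments.
Unset Strict Implicit.
Unset Printing Implicit Defensive.

Import Order.TTheory GRing.Theory Num.Theory.
Import numFieldNormedType.Exports.

Local Open Scope ring_scope.
Local Open Scope classical_set_scope.

(* The ground field K is a numFieldType with its norm topology, so that
   [derivable], [differentiable] and [derive1] mean real differentiability for
   K = R and complex differentiability for K = R[i].  Functions are total; they
   are only constrained on the open sets that serve as their domains. *)

Section Smoothness.
Variable K : numFieldType.

Definition smooth (D : set K) (f : K -> K) : Prop :=
  forall (n : nat) (t : K), D t -> derivable (f^`(n)) t 1.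

Definition partial_t (f : K * K -> K) : K * K -> K :=
  fun p => (fun s => f (s, p.2))^`() p.1.

Definition partial_x (f : K * K -> K) : K * K -> K :=
  fun p => (fun s => f (p.1, s))^`() p.2.

Definition iterated_partial (w : seq bool) (f : K * K -> K) : K * K -> K :=
  foldr (fun b g => if b then partial_x g else partial_t g) f w.

(* On an open set this is the usual C^oo: if all iterated partial derivatives
   are (Frechet) differentiable, they are in particular all continuous. *)
Definition smooth2 (W : set (K * K)) (f : K * K -> K) : Prop :=
  forall (w : seq bool) (p : K * K), W p ->
    differentiable (iterated_partial w f) p.

End Smoothness.

Section JetSpace.
Variable K : numFieldType.

(* A point of the jet space is (t, y), where y k is the coordinate x^(k).  A
   function of order at most n depends only on t and y 0, ..., y n. *)
Definition jet_fun := K -> (nat -> K) -> K.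

Definition partial_jet (j : nat) (g : jet_fun) : jet_fun :=
  fun t y => (fun s => g t [eta y with j |-> s])^`() (y j).

(* D_t = d/dt + x^(1) d/dx + ... + x^(n+1) d/dx^(n), for functions of order at
   most n. *)
Definition total_deriv (n : nat) (g : jet_fun) : jet_fun :=
  fun t y => (fun s => g s y)^`()%classic t + \sum_(j < n.+1) y j.+1 * partial_jet j g t y.

End JetSpace.

Section LinearODE.
Variable K : numFieldType.

(* Only coef 1, ..., coef (r-1) are used; the order r is a parameter of the
   predicates below. *)
Record ode := Ode {
  dom : set K;
  coef : nat -> K -> K;
  rhs : K -> K
}.

Definition in_A1 (r : nat) (E : ode) : Prop :=
  [/\ open (dom E),
      forall i : nat, (0 < i < r)%N -> smooth (dom E) (coef E i)
    & smooth (dom E) (rhs E)].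

Definition satisfies (r : nat) (E : ode) (t : K) (y : nat -> K) : Prop :=
  y r + \sum_(1 <= i < r) coef E i t * y i = rhs E t.

Definition homogeneous (E : ode) : ode := Ode (dom E) (coef E) (fun=> 0).

Definition solution_on (r : nat) (E : ode) (D : set K) (f : K -> K) : Prop :=
  [/\ D `<=` dom E, smooth D f
    & forall t, D t -> satisfies r E t (fun k => f^`(k) t)].

End LinearODE.

Section PointTransformations.
Variable K : numFieldType.

Record transf := Transf {
  tdom : set (K * K);
  tT : K * K -> K;
  tX : K * K -> K
}.

Definition base (P : transf) : set K := [set t | exists x, tdom P (t, x)].

Definition restrict_base (P : transf) (U : set K) : transf :=
  Transf (tdom P `&` [set p | U p.1]) (tT P) (tX P).

(* Without connectedness of the fibres over t, T_x = 0 on W would not imply that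
   T is a function of t alone.  Every box is suitable. *)
Definition suitable_domain (W : set (K * K)) : Prop :=
  [/\ open W, W !=set0 & forall t, connected [set x | W (t, x)]].

Definition jacobian_det (P : transf) (p : K * K) : K :=
  partial_t (tT P) p * partial_x (tX P) p - partial_x (tT P) p * partial_t (tX P) p.

Definition point_transformation (P : transf) : Prop :=
  [/\ suitable_domain (tdom P), smooth2 (tdom P) (tT P), smooth2 (tdom P) (tX P)
    & forall p, tdom P p -> jacobian_det P p != 0].

Definition DT (P : transf) : jet_fun K :=
  total_deriv 0 (fun t y => tT P (t, y 0%N)).

(* The expression of the transformed derivative of order k on the jet space:
   ((1 / D_t T) D_t)^k X, a function of order at most k. *)
Fixpoint prolong (P : transf) (k : nat) : jet_fun K :=
  if k is k'.+1 then fun t y => total_deriv k' (prolong P k') t y / DT P t y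
  else fun t y => tX P (t, y 0%N).

(* The r-th prolongation of P, which is defined where D_t T does not vanish,
   identifies the equation E with the equation Et, both being viewed as subsets
   of the jet space of order r. *)
Definition maps_ode (r : nat) (E Et : ode K) (P : transf) : Prop :=
  (forall p, tdom P p -> dom E p.1 /\ dom Et (tT P p)) /\
  (forall (t : K) (y : nat -> K), tdom P (t, y 0%N) -> DT P t y != 0 ->
     satisfies r E t y <->
     satisfies r Et (tT P (t, y 0%N)) (fun k => prolong P k t y)).

Definition admissible (r : nat) (E Et : ode K) (P : transf) : Prop :=
  [/\ in_A1 r E, in_A1 r Et, point_transformation P & maps_ode r E Et P].

(* Solutions and the functions T, X0 are taken on the projection of the domain
   of P to the t-axis. *)
Definition of_the_form (r : nat) (E : ode K) (P : transf) : Prop :=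
  exists T X0 psi1 : K -> K,
  [/\ smooth (base P) T /\ smooth (base P) X0,
      forall t, base P t -> T^`() t != 0,
      solution_on r (homogeneous E) (base P) psi1,
      forall t, base P t -> psi1 t != 0
    & forall t x, tdom P (t, x) ->
        tT P (t, x) = T t /\ tX P (t, x) = x / psi1 t + X0 t].

End PointTransformations.

(* Main.v *)
(* Admissible transformations have the stated form: on the jets of the source
   equation the prolongation of order r turns into an identity that is rational
   in x^(1), ..., x^(r-1), since these coordinates are free.

   - T does not depend on x.  Otherwise let the total derivative D_t T tend to 0
     along jets of the source equation with D_t D_t T = 1, which is possible
     because x^(2) is free when r >= 3: after clearing denominators, the target
     equation forces a nonvanishing multiple of the Jacobian to vanish.
   - X is affine in x, because the coefficient of x^(1) x^(r-1) in the r-th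
     transformed derivative is r X_xx / T_t^r and no other term produces this
     monomial.
   - If X = x / psi + X0, then passing from x to x + e psi adds the constant e to
     the new unknown function.  Equations in the first Arnold form do not involve
     the unknown function itself, so psi solves the homogeneous equation.

   Conversely, for transformations of the stated form the jets are expressed
   affinely through the transformed ones; the coefficient of the new unknown
   function in the transformed equation is the homogeneous source operator applied
   to psi, that is 0.  The new coefficients become functions of the new variable by
   the inverse function theorem, proved for R and C at once from the mean value
   inequality and the existence of minima on closed balls. *)

Require Import Defs.
From mathcomp Require Import all_boot all_order all_algebra.
From mathcomp Require Import all_classical all_reals all_analysis.
From mathcomp Require Import ring zify.

Set Implicit Arguments.
Unset Strict Implicit.
Unset Printing Implicit Defensive.

Import Order.TTheory GRing.Theory Num.Theory.
Import numFieldNormedType.Exports.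

Local Open Scope ring_scope.
Local Open Scope classical_set_scope.

(** * Calculus in one variable *)

Section Calculus.
Variable F : numFieldType.
Implicit Types f g : F -> F.

Lemma is_derive_derive1 f (t : F) (d : F) : is_derive t 1 f d -> f^`() t = d.
Proof. by move=> fd; rewrite derive1E derive_val. Qed.

Lemma derivable_is_derive f (t : F) : derivable f t 1 -> is_derive t 1 f (f^`() t).
Proof. by move=> fd; rewrite derive1E; exact: derivableP. Qed.

Lemma is_derive1D f g (t : F) (a b : F) : is_derive t 1 f a -> is_derive t 1 g b ->
  is_derive t 1 (fun s => f s + g s) (a + b).
Proof. exact: is_deriveD. Qed.

Lemma is_derive1M f g (t : F) (a b : F) : is_derive t 1 f a -> is_derive t 1 g b ->
  is_derive t 1 (fun s => f s * g s) (a * g t + f t * b).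
Proof. by move=> fa gb; have := is_deriveM fa gb; rewrite addrC [g t *: a]mulrC. Qed.

Lemma is_derive1V f (t : F) (a : F) : f t != 0 -> is_derive t 1 f a ->
  is_derive t 1 (fun s => (f s)^-1) (- a / f t ^+ 2).
Proof.
move=> ft0 [df <-]; split; first exact: derivableV.
by rewrite deriveV // -[LHS]/(_ * _) mulrC mulrN mulNr.
Qed.

Lemma is_derive1_comp f g (t : F) (a b : F) : is_derive t 1 f a -> is_derive (f t) 1 g b ->
  is_derive t 1 (g \o f) (b * a).
Proof.
move=> [df fa] [dg gb].
have df' : differentiable f t by exact/derivable1_diffP.
have dg' : differentiable g (f t) by exact/derivable1_diffP.
have dgf : differentiable (g \o f) t by exact: differentiable_comp.
split; first exact/derivable1_diffP.
rewrite deriveE // diff_comp //= -[X in 'd g _ X]/('d f t 1) -[in X in 'd g _ X]deriveE // fa.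
by rewrite deriv1E // derive1E gb mulrC.
Qed.

Lemma is_derive1_affine (w v s : F) : is_derive s 1 (fun s => w + s * v) v.
Proof.
have := is_derive1D (is_derive_cst w s 1)
  (is_derive1M (is_derive_id s 1) (is_derive_cst v s 1)).
by rewrite /= add0r mul1r mulr0 addr0.
Qed.

Lemma is_derive1_sum n (f : 'I_n -> F -> F) (t : F) (a : 'I_n -> F) :
  (forall i, is_derive t 1 (f i) (a i)) ->
  is_derive t 1 (fun s => \sum_(i < n) f i s) (\sum_(i < n) a i).
Proof.
move=> fa; have := is_derive_sum fa; congr is_derive.
by apply/funext => s; rewrite fct_sumE.
Qed.

Lemma near_eq_derive1 f g (t : F) : (\forall s \near t, f s = g s) -> f^`() t = g^`() t.
Proof. by move=> fg; rewrite !derive1E; exact: near_eq_derive. Qed.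

End Calculus.

(** * The mean value inequality and minima over R and C *)

(** Together with [norm_attains_min], this is the analytic input that R and C have to supply by
    separate proofs. What follows them is argued over a [numFieldType] having these properties where
    needed. *)
Definition mean_value_inequality (F : numFieldType) : Prop :=
  forall (f : F -> F) (a e M : F),
  (forall z, `|a - z| < e -> derivable f z 1 /\ `|f^`() z| <= M) ->
  forall z w, `|a - z| < e -> `|a - w| < e -> `|f z - f w| <= M * `|z - w|.

Definition norm_attains_min (F : numFieldType) : Prop :=
  forall (f : F -> F) (a e : F), 0 <= e ->
  (forall z, `|a - z| <= e -> {for z, continuous f}) ->
  exists2 z, `|a - z| <= e & forall w, `|a - w| <= e -> `|f z| <= `|f w|.

Lemma ball_segment (F : numFieldType) (a e z w s : F) : 0 <= s <= 1 ->
  `|a - z| < e -> `|a - w| < e -> `|a - (w + s * (z - w))| < e.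
Proof.
move=> /andP[s0 s1] az aw.
have -> : a - (w + s * (z - w)) = (1 - s) * (a - w) + s * (a - z) by ring.
have s1' : 0 <= 1 - s by rewrite subr_ge0.
apply: (le_lt_trans (ler_normD _ _)); rewrite !normrM (ger0_norm s0) (ger0_norm s1').
(* Strictness below comes from the summand with factor s, so s = 0 is treated apart. *)
have [->|sn0] := eqVneq s 0; first by rewrite subr0 mul1r mul0r addr0.
rewrite [ltRHS](_ : e = (1 - s) * e + s * e); last by ring.
apply: ler_ltD; first by rewrite ler_wpM2l // ltW.
by rewrite ltr_pM2l // lt_def sn0.
Qed.

Lemma MVT_unit (R : realType) (g dg : R -> R) :
  (forall s : R, 0 <= s <= 1 -> is_derive s 1 g (dg s)) ->
  exists2 s : R, 0 <= s <= 1 & g 1 - g 0 = dg s.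
Proof.
move=> gd; have [||s] := @MVT_segment R g dg 0 1 ler01.
- by move=> x; rewrite in_itv /= => /andP[/ltW x0 /ltW x1]; apply: gd; rewrite x0.
- by apply: derivable_within_continuous => x; rewrite in_itv /= => x01;
    have [] := gd x x01.
- by rewrite in_itv /= => s01 ->; exists s => //; rewrite subr0 mulr1.
Qed.

Lemma real_mean_value_inequality (R : realType) :
  mean_value_inequality (R : numFieldType).
Proof.
move=> f a e M fd z w az aw.
pose g (s : R) := f (w + s * (z - w)).
have gd (s : R) : 0 <= s <= 1 -> is_derive s 1 g (f^`()%classic (w + s * (z - w)) * (z - w)).
  move=> s01; have [df _] := fd _ (ball_segment s01 az aw).
  apply: (@is_derive1_comp (R : numFieldType) _ f _ _ _ (is_derive1_affine _ _ _)).
  exact: (@derivable_is_derive (R : numFieldType)).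
have [s s01] := MVT_unit gd; rewrite /g mul1r mul0r addr0 [w + _]addrC subrK => ->.
by rewrite normrM ler_wpM2r //; have [] := fd _ (ball_segment s01 az aw).
Qed.

Lemma real_norm_attains_min (R : realType) : norm_attains_min (R : numFieldType).
Proof.
move=> f a e e0 fc.
have [||z] := @EVT_min R (fun z => `|f z|) (a - e) (a + e).
- by rewrite lerBlDr -addrA lerDl addr_ge0.
- apply/continuous_in_subspaceT => z /[1!inE]; rewrite /= in_itv /= => zae.
  apply: continuous_comp (@norm_continuous _ R^o _).
  by apply: fc; rewrite distrC ler_distl.
- rewrite in_itv /= -ler_distl distrC => az zmin; exists z => // w aw.
  by apply: zmin; rewrite in_itv /= -ler_distl distrC.
Qed.

(** Source and target are different fields when this is applied to the embedding of R into C and to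
    real parts. *)
Lemma uniformly_continuous_norm (F G : numFieldType) (f : F -> G) :
  (forall e, 0 < e -> exists2 d, 0 < d &
     forall z w, `|z - w| < d -> `|f z - f w| < e) -> continuous f.
Proof.
move=> H z; apply/(@cvgrPdist_lt G G F (nbhs z)) => e /H[d d0 Hd]; near=> w; apply: Hd.
by near: w; exact: cvgr_dist_lt.
Unshelve. all: by end_near. Qed.

(** * The complex case: segments and compact discs *)

Section Complex.
Variable R : realType.
Local Notation C := (R[i] : numFieldType).
Local Open Scope complex_scope.

(** In the partial order of C comparable elements have equal imaginary parts, so every positive
    radius is real. *)
Lemma gt0_complex (e : C) : 0 < e -> exists2 d : R, 0 < d & e = d%:C.
Proof.
by case: e => d i; rewrite ltcE /= => /andP[/eqP -> d0]; exists d.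
Qed.

Lemma norm_real_complex (x : R) : `|x%:C : C| = `|x|%:C.
Proof. by rewrite normc_def /= expr0n addr0 sqrtr_sqr. Qed.

Lemma Re_le_norm (z : C) : (complex.Re z)%:C <= `|z|.
Proof.
by apply: le_trans (normc_ge_Re z); rewrite lecR; apply: ler_norm.
Qed.

Lemma Re_norm (z : C) : (complex.Re `|z|)%:C = `|z|.
Proof. by rewrite normc_def. Qed.

Lemma real_complex_continuous : continuous (real_complex R : R -> C).
Proof.
apply: (@uniformly_continuous_norm (R : numFieldType) C) => e /gt0_complex[d d0 ->].
by exists d => // z w; rewrite -rmorphB norm_real_complex ltcR.
Qed.

Lemma Re_continuous : continuous (@complex.Re R : C -> R).
Proof.
apply: (@uniformly_continuous_norm C (R : numFieldType)) => e e0.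
exists e%:C => [|z w zw]; first by rewrite ltcR.
by rewrite -ltcR -raddfB; apply: le_lt_trans (normc_ge_Re _) zw.
Qed.

(** The real difference quotient in h is the real part of u times the complex quotient at the
    increment h v, times v. For nonzero v, the increment h v tends to 0 in C without meeting 0. *)
Lemma is_derive_Re_segment (f : C -> C) (u w v : C) (s : R) :
  derivable f (w + s%:C * v) 1 ->
  is_derive s 1 (fun s : R => complex.Re (u * f (w + s%:C * v)))
    (complex.Re (u * f^`()%classic (w + s%:C * v) * v)).
Proof.
have [->|vn0] := eqVneq v 0.
  move=> _; rewrite mulr0 /= (_ : (fun _ => _) = cst (complex.Re (u * f w))).
    exact: is_derive_cst.
  by apply/funext => h; rewrite mulr0 addr0.
move=> df; set p := w + s%:C * v.
suff H : (fun h : R => h^-1 *: (((fun s : R => complex.Re (u * f (w + s%:C * v)))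
    \o shift s) (h *: 1) - complex.Re (u * f p))) @ 0^' -->
    complex.Re (u * f^`()%classic p * v).
  by split; [apply/cvg_ex; eexists; exact: H | exact: cvg_lim H].
have cvf : (fun k : C => k^-1 *: ((f \o shift p) (k *: 1) - f p)) @ 0^' --> f^`()%classic p.
  by rewrite derive1E; exact: df.
have cv0 : (fun h : R => h%:C * v : C) @ (0 : R) --> (0 : C).
  rewrite -[X in _ --> X](mul0r v).
  by apply: cvgM; [exact: real_complex_continuous | exact: cvg_cst].
have cvv : (fun h : R => h%:C * v : C) @ 0^' --> (0 : C)^'.
  move=> P /cv0 /= H.
  apply: (@filterS R (nbhs (0 : R)) _ _ _ _ H) => h Ph hn0.
  by apply: Ph; rewrite mulf_neq0 // -[0]/((0:R)%:C) (inj_eq (@complexI _)).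
have := cvg_comp _ _ cvv cvf => /(cvgM (cvg_cst u)) /(fun H => cvgM H (cvg_cst v)).
move=> H; have := cvg_comp _ _ H (@Re_continuous _).
apply: cvg_trans; apply: near_eq_cvg; near=> h => /=.
have hn0 : h != 0 by near: h; exact: nbhs_dnbhs_neq.
have hn0' : h%:C != 0 :> C by rewrite -[0]/((0:R)%:C) (inj_eq (@complexI _)).
have -> : w + (h%:A + s)%:C * v = (h%:C * v)%:A + p.
  by rewrite -[(h%:C * v)%:A]/(_ * _) -[h%:A]/(_ * _) !mulr1 rmorphD /= /p; ring.
set B := f (_ + p).
have -> : u * ((h%:C * v)^-1 *: (B - f p)) * v = h^-1%:C * (u * B - u * f p).
  rewrite -[_ *: _]/(_ * _) fmorphV /=; field; rewrite ?hn0' ?vn0 //.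
rewrite -raddfB /=; case: (u * B - u * f p) => x y /=.
by rewrite mul0r subr0.
Unshelve. all: by end_near. Qed.

(** Multiplying by a unit u turns the increment D into the real number |D|; the real mean value
    theorem then applies to the real part of u f along the segment from w to z. *)
Lemma complex_mean_value_inequality : mean_value_inequality C.
Proof.
move=> f a e M fd z w az aw.
(* If D = 0, only M >= 0 is needed, and this holds because M bounds the norm of the derivative at
   z. *)
set D := f z - f w; have [->|Dn0] := eqVneq D 0.
  rewrite normr0 mulr_ge0 //; have [_] := fd z az; exact: le_trans.
have [u nu uD] : exists2 u : C, `|u| = 1 & u * D = `|D|.
  by exists (`|D| / D); rewrite ?mulfVK // normrM normfV normr_id mulfV // normr_eq0.
have s01 (s : R) : 0 <= s <= 1 -> (0 : C) <= s%:C <= 1.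
  by rewrite -[(1 : C)]/(1%:C) -[(0 : C)]/(0%:C) !lecR.
have [|s] := @MVT_unit R (fun s => complex.Re (u * f (w + s%:C * (z - w))))
  (fun s => complex.Re (u * f^`()%classic (w + s%:C * (z - w)) * (z - w))).
  move=> s hs; apply: is_derive_Re_segment.
  by have [] := fd _ (ball_segment (s01 _ hs) az aw).
move=> /s01 hs; rewrite mul1r mul0r addr0 [w + _]addrC subrK -raddfB /= -mulrBr -/D.
rewrite uD => /(congr1 (real_complex _)); rewrite Re_norm => ->.
apply: le_trans (Re_le_norm _) _; rewrite !normrM nu mul1r ler_wpM2r //.
by have [] := fd _ (ball_segment hs az aw).
Qed.

Lemma Re_normB_continuous (a : C) : continuous (fun z : C => complex.Re `|a - z|).
Proof.
apply: (@uniformly_continuous_norm C (R : numFieldType)) => d d0.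
exists d%:C => [|x y xy]; first by rewrite ltcR.
rewrite -ltcR -raddfB; apply: le_lt_trans (normc_ge_Re _) _.
apply: le_lt_trans (ler_dist_dist _ _) _.
by rewrite (_ : a - x - (a - y) = - (x - y)) ?normrN //; ring.
Qed.

(** The disc is a closed subset of the circumscribed square, which is the continuous image of a
    product of two compact real intervals. *)
Lemma complex_closed_ball_compact (a : C) (e : R) :
  compact [set z : C | `|a - z| <= e%:C].
Proof.
pose m (p : R * R) : C := p.1%:C + 'i * p.2%:C.
have mc : continuous m.
  move=> p; apply: cvgD.
    by apply: continuous_comp; [exact: cvg_fst|exact: real_complex_continuous].
  apply: cvgM; first exact: cvg_cst.
  by apply: continuous_comp; [exact: cvg_snd|exact: real_complex_continuous].
pose S (x : R) := `[x - e, x + e]%classic : set R.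
have cS : compact (m @` (S (complex.Re a) `*` S (complex.Im a))).
  apply: continuous_compact; first exact: continuous_subspaceT.
  by apply: compact_setX; exact: segment_compact.
apply: subclosed_compact cS _.
  have -> : [set z : C | `|a - z| <= e%:C] =
     (fun z : C => complex.Re `|a - z|) @^-1` [set x | x <= e].
    by apply/seteqP; split => z /=; rewrite -{1}(Re_norm (a - z)) lecR.
  apply: (@preimage_closed _ _ _ _ _); last exact: closed_le.
  by move=> z _; exact: Re_normB_continuous.
move=> z /= az; exists (complex.Re z, complex.Im z); last by rewrite /m /= -complexE.
split; rewrite /S /= in_itv /= -ler_distl distrC -lecR -raddfB.
  exact: le_trans (normc_ge_Re _) az.
apply: le_trans az; rewrite normc_def lecR -sqrtr_sqr ler_wsqrtr //.
by rewrite lerDr sqr_ge0.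
Qed.

Lemma complex_norm_attains_min : norm_attains_min C.
Proof.
move=> f a e e0 fc; have [d ed] : exists d : R, e = d%:C.
  by exists (complex.Re e); rewrite RRe_real // ger0_real.
rewrite ed in e0 fc *.
have [|||z] := @compact_EVT_min _ R (fun z => complex.Re `|f z|)
   [set z : C | `|a - z| <= d%:C].
- by exists a => /=; rewrite subrr normr0.
- exact: complex_closed_ball_compact.
- apply/continuous_in_subspaceT => z /[1!inE] /= az.
  have <- : (fun z => complex.Re `|0 - f z|) = (fun z => complex.Re `|f z|).
    by apply/funext => w; rewrite sub0r normrN.
  exact: cvg_comp (fc z az) (@Re_normB_continuous 0 (f z)).
- rewrite inE /= => az zmin; exists z => // w aw.
  by rewrite -(Re_norm (f z)) -(Re_norm (f w)) lecR; apply: zmin; rewrite inE.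
Qed.

End Complex.

(** * Smooth functions and the inverse function theorem *)

Section SmoothFunctions.
Variable F : numFieldType.
Implicit Types (D U : set F) (f g : F -> F) (t : F).

Lemma open_near D t : open D -> D t -> \forall s \near t, D s.
Proof. by move=> oD Dt; exact: open_nbhs_nbhs. Qed.

(** Smoothness is restated by peeling off the first derivative instead of the last one, so that
    closure under an operation follows by induction from its differentiation rule. *)
Fixpoint n_derivable D n f : Prop :=
  if n is m.+1 then (forall t, D t -> derivable f t 1) /\ n_derivable D m f^`()
  else True.

Lemma smoothP D f : smooth D f <-> forall n, n_derivable D n f.
Proof.
split=> [sf n|nf n t].
  suff: forall k, n_derivable D n (f^`(k)) by move/(_ 0%N).
  by elim: n => //= n IH k; split=> [t|]; [exact: sf|exact: IH k.+1].
have: n_derivable D 1 (f^`(n)).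
  move: (nf n.+1); elim: n f {nf} => // n IH f [_ /IH].
  by rewrite derive1Sn.
by case=> + _; exact.
Qed.

Lemma n_derivableW D n f : n_derivable D n.+1 f -> n_derivable D n f.
Proof. by elim: n f => // n IH f [df /IH]. Qed.

Section Open.
Variable D : set F.
Hypothesis oD : open D.

Lemma derive1_eq_on f g t : (forall s, D s -> f s = g s) -> D t -> f^`() t = g^`() t.
Proof.
by move=> fg Dt; apply: near_eq_derive1; apply: filterS (open_near oD Dt).
Qed.

Lemma derivable_eq_on f g t : (forall s, D s -> f s = g s) -> D t ->
  derivable f t 1 -> derivable g t 1.
Proof.
by move=> fg Dt; apply: near_eq_derivable; apply: filterS (open_near oD Dt).
Qed.

Lemma n_derivable_eq n f g : (forall s, D s -> f s = g s) ->
  n_derivable D n f -> n_derivable D n g.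
Proof.
elim: n f g => //= n IH f g fg [df nf]; split.
  by move=> t Dt; apply: derivable_eq_on (df t Dt).
by apply: IH nf => t Dt; exact: derive1_eq_on.
Qed.

Lemma smooth_eq f g : (forall s, D s -> f s = g s) -> smooth D f -> smooth D g.
Proof.
by move=> fg /smoothP sf; apply/smoothP => n; exact: n_derivable_eq (sf n).
Qed.

Lemma n_derivableS n f g : (forall t, D t -> is_derive t 1 f (g t)) ->
  n_derivable D n g -> n_derivable D n.+1 f.
Proof.
move=> fg ng; split=> [t /fg[]//|]; apply: n_derivable_eq ng => t Dt.
by rewrite (is_derive_derive1 (fg t Dt)).
Qed.

Lemma n_derivable_is_derive n f t : n_derivable D n.+1 f -> D t ->
  is_derive t 1 f (f^`() t).
Proof. by case=> df _ Dt; apply: derivable_is_derive; exact: df. Qed.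

Lemma n_derivableD n f g : n_derivable D n f -> n_derivable D n g ->
  n_derivable D n (fun t => f t + g t).
Proof.
elim: n f g => // n IH f g nf ng; apply: n_derivableS (IH _ _ nf.2 ng.2).
by move=> t Dt; apply: is_derive1D;
    [exact: n_derivable_is_derive nf Dt|exact: n_derivable_is_derive ng Dt].
Qed.

Lemma n_derivableM n f g : n_derivable D n f -> n_derivable D n g ->
  n_derivable D n (fun t => f t * g t).
Proof.
elim: n f g => // n IH f g nf ng.
apply: (@n_derivableS _ _ (fun t => f^`()%classic t * g t + f t * g^`()%classic t)).
  by move=> t Dt; apply: is_derive1M;
    [exact: n_derivable_is_derive nf Dt|exact: n_derivable_is_derive ng Dt].
apply: n_derivableD; apply: IH; [exact: nf.2| |  |exact: ng.2];
  exact: n_derivableW.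
Qed.

Lemma n_derivable_cst n (c : F) : n_derivable D n (fun=> c).
Proof.
elim: n c => // n IH c; apply: n_derivableS (IH 0) => t _; exact: (is_derive_cst c t 1).
Qed.

Lemma n_derivable_id n : n_derivable D n id.
Proof.
by case: n => // n; apply: n_derivableS (n_derivable_cst n 1) => t _.
Qed.

(** The derivative -f' (1/f)^2 contains 1/f again, so the induction runs on n with f fixed. *)
Lemma n_derivableV n f : (forall t, D t -> f t != 0) -> n_derivable D n f ->
  n_derivable D n (fun t => (f t)^-1).
Proof.
move=> f0; elim: n => // n IH nf.
apply: (@n_derivableS _ _
  (fun t => (-1 * f^`()%classic t) * ((f t)^-1 * (f t)^-1))).
  move=> t Dt; have := is_derive1V (f0 t Dt) (n_derivable_is_derive nf Dt).
  by rewrite mulN1r expr2 invfM.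
have nV : n_derivable D n (fun t => (f t)^-1) by apply: IH; exact: n_derivableW.
apply: n_derivableM; last exact: n_derivableM.
by apply: n_derivableM; [exact: n_derivable_cst|exact: nf.2].
Qed.

Lemma smooth_cst (c : F) : smooth D (fun=> c).
Proof. by apply/smoothP => n; exact: n_derivable_cst. Qed.

Lemma smooth_id : smooth D id.
Proof. by apply/smoothP => n; exact: n_derivable_id. Qed.

Lemma smoothD f g : smooth D f -> smooth D g -> smooth D (fun t => f t + g t).
Proof.
by move=> /smoothP sf /smoothP sg; apply/smoothP => n; exact: n_derivableD.
Qed.

Lemma smoothM f g : smooth D f -> smooth D g -> smooth D (fun t => f t * g t).
Proof.
by move=> /smoothP sf /smoothP sg; apply/smoothP => n; exact: n_derivableM.
Qed.

Lemma smoothV f : (forall t, D t -> f t != 0) -> smooth D f ->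
  smooth D (fun t => (f t)^-1).
Proof.
by move=> f0 /smoothP sf; apply/smoothP => n; exact: n_derivableV.
Qed.

Lemma smooth_sum (I : eqType) (s : seq I) (P : pred I) (f : I -> F -> F) :
  (forall i, i \in s -> P i -> smooth D (f i)) ->
  smooth D (fun t => \sum_(i <- s | P i) f i t).
Proof.
elim: s => [|i s IH] sf.
  by rewrite (_ : (fun _ => _) = fun=> 0); [exact: smooth_cst|
     apply/funext => t; rewrite big_nil].
have {}IH : smooth D (fun t => \sum_(i <- s | P i) f i t).
  by apply: IH => j js; apply: sf; rewrite inE js orbT.
under [X in smooth D X]funext do rewrite big_cons.
case Pi: (P i); last exact: IH.
by apply: smoothD IH; apply: sf Pi; rewrite inE eqxx.
Qed.

End Open.

Lemma smooth_derive1 D f : smooth D f -> smooth D f^`().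
Proof. by move=> sf n t Dt; rewrite -derive1Sn; exact: sf. Qed.

Lemma smooth_derive1n D f n : smooth D f -> smooth D f^`(n).
Proof. by move=> sf; elim: n => [//|n IH]; exact: smooth_derive1 IH. Qed.

Lemma smooth_is_derive D f t : smooth D f -> D t -> is_derive t 1 f (f^`() t).
Proof. by move=> sf Dt; apply: derivable_is_derive; exact: (sf 0%N). Qed.

Lemma smooth_sub D U f : U `<=` D -> smooth D f -> smooth U f.
Proof. by move=> UD sf n t /UD; exact: sf. Qed.

Lemma n_derivable_comp D U n f g : open D -> (forall t, D t -> U (g t)) ->
  n_derivable U n f -> n_derivable D n g -> n_derivable D n (f \o g).
Proof.
move=> oD gU; elim: n f => // n IH f nf ng.
apply: (@n_derivableS _ oD _ _ (fun t => (f^`() \o g) t * g^`()%classic t)).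
  move=> t Dt; apply: is_derive1_comp; first exact: n_derivable_is_derive ng Dt.
  exact: n_derivable_is_derive nf (gU t Dt).
apply: n_derivableM => //; last exact: ng.2.
by apply: IH; [exact: nf.2|exact: n_derivableW].
Qed.

Lemma smooth_comp D U f g : open D -> (forall t, D t -> U (g t)) ->
  smooth U f -> smooth D g -> smooth D (f \o g).
Proof.
move=> oD gU /smoothP sf /smoothP sg; apply/smoothP => n.
exact: n_derivable_comp (sf n) (sg n).
Qed.

(** Bootstrapping: g' is the composite of 1/f' with g, so n derivatives of g yield n + 1. *)
Lemma smooth_inverse D U f g : open D -> open U -> (forall w, D w -> U (g w)) ->
  smooth U f -> (forall s, U s -> f^`() s != 0) ->
  (forall w, D w -> is_derive w 1 g (f^`()%classic (g w))^-1) -> smooth D g.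
Proof.
move=> oD oU gU sf f0 gd; apply/smoothP; elim=> // n IH.
apply: (@n_derivableS _ oD _ _ ((fun s => (f^`()%classic s)^-1) \o g)) => //.
apply: n_derivable_comp gU _ IH => //; apply: n_derivableV => //.
by have /smoothP := smooth_derive1 sf; exact.
Qed.

End SmoothFunctions.

(** * Connectedness and local inversion *)

Section InverseFunction.
Variable F : numFieldType.
Hypothesis mvi : mean_value_inequality F.
Hypothesis nam : norm_attains_min F.
Implicit Types (A D : set F) (f : F -> F).

Lemma open_ballP A z : open A -> A z ->
  exists2 e : F, 0 < e & forall w, `|z - w| < e -> A w.
Proof.
by move=> oA Az; have /nbhs_ballP[e e0 He] := open_nbhs_nbhs (conj oA Az); exists e.
Qed.

Lemma openP A : (forall z, A z ->
  exists2 e : F, 0 < e & forall w, `|z - w| < e -> A w) -> open A.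
Proof.
move=> H; rewrite openE => z /H[e e0 He]; apply/nbhs_ballP; exists e => //.
Qed.

Lemma derive0_ball f (z e : F) : (forall w, `|z - w| < e -> is_derive w 1 f 0) ->
  forall w, `|z - w| < e -> f w = f z.
Proof.
move=> fd w zw; apply/eqP; rewrite -subr_eq0 -normr_le0.
have e0 : 0 < e by exact: le_lt_trans zw.
rewrite -(mul0r `|w - z|); apply: (mvi (a := z) (e := e)) => //; last by rewrite subrr normr0.
by move=> y /fd yd; split; [case: yd|rewrite (is_derive_derive1 yd) normr0].
Qed.

(** By [derive0_ball] the function is locally constant, so the points of A where it takes the value
    f z form a subset that is both open and closed in A. *)
Lemma derive0_connected A f : open A -> connected A ->
  (forall z, A z -> is_derive z 1 f 0) -> forall z w, A z -> A w -> f z = f w.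
Proof.
move=> oA cA fd z w Az Aw.
have loc y : A y -> exists2 e : F, 0 < e & forall x, `|y - x| < e -> A x /\ f x = f y.
  move=> /(open_ballP oA)[e e0 He]; exists e => // x yx; split; first exact: He.
  by apply: derive0_ball yx => v /He; exact: fd.
suff AE : A = A `&` [set y | f z = f y] by move: Aw; rewrite AE => -[].
symmetry; apply: cA; first by exists z.
  exists (A `&` [set y | f z = f y]); last by rewrite setIA setIid.
  apply: openP => y [Ay fy]; have [e e0 He] := loc y Ay; exists e => // x /He[Ax fx].
  by split=> //=; rewrite fx.
exists (~` (A `&` [set y | f z != f y])).
  apply: open_closedC; apply: openP => y [Ay fy].
  have [e e0 He] := loc y Ay; exists e => // x /He[Ax fx].
  by split=> //=; rewrite fx.
apply/seteqP; split=> y /= [Ay fy]; split=> //.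
  by move=> [_]; rewrite fy eqxx.
by apply/eqP/negP => /negP fy'; apply: fy.
Qed.

(** The indicator function of a set that is open and closed has derivative 0 everywhere, hence is
    constant by the mean value inequality. *)
Lemma connectedT : connected [set: F].
Proof.
move=> B [z Bz] [C oC BC] [C' cC' BC']; apply/seteqP; split=> // w _.
have {BC}BC : B = C by rewrite BC setTI.
have {BC'}BC' : B = C' by rewrite BC' setTI.
pose f y : F := if y \in B then 1 else 0.
suff : f w = f z.
  rewrite /f (mem_set Bz); case: ifPn => [/set_mem //|_ /eqP].
  by rewrite eq_sym oner_eq0.
apply: (@derive0_ball f z (`|z - w| + 1)); last by rewrite ltrDl.
move=> y _; have [By|nBy] := pselect (B y).
  have : \forall x \near y, 1 = f x.
    have : \forall x \near y, B x by apply: open_near By; rewrite BC.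
    by apply: filterS => x Bx; rewrite /f mem_set.
  by move/near_eq_is_derive; apply; exact: (is_derive_cst _ y 1).
have : \forall x \near y, 0 = f x.
  have : \forall x \near y, (~` B) x by apply: open_near nBy; rewrite BC'; exact: closed_openC.
  by apply: filterS => x Bx; rewrite /f memNset.
by move/near_eq_is_derive; apply; exact: (is_derive_cst _ y 1).
Qed.

Lemma derivable_continuous_at (f : F -> F) (z : F) : derivable f z 1 ->
  {for z, continuous f}.
Proof. by move=> /derivable1_diffP; exact: differentiable_continuous. Qed.

Lemma continuous_ball (f : F -> F) (z e : F) : {for z, continuous f} -> 0 < e ->
  \forall w \near z, `|f z - f w| < e.
Proof. by move=> /(@cvgrPdist_lt F F F (nbhs z)) fc /fc. Qed.

(** The difference quotient of S at w with increment h is the inverse of that of T at t with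
    increment S (w + h) - t. The expansion bound makes this increment tend to 0, and T (S v) = v
    keeps it nonzero. *)
Lemma expanding_derivable_inverse (T S : F -> F) (t w a K : F) :
  0 < K -> is_derive t 1 T a -> a != 0 -> S w = t ->
  (\forall v \near w, T (S v) = v /\ K * `|S v - t| <= `|v - w|) ->
  is_derive w 1 S a^-1.
Proof.
move=> K0 [dT Ta] a0 Sw near_w.
have Tt : T t = w by rewrite -Sw; have [] := nbhs_singleton near_w.
have near0 : \forall h \near (0 : F), T (S (h *: 1 + w)) = h *: 1 + w /\
    K * `|S (h *: 1 + w) - t| <= `|h|.
  have : (fun h : F => h *: 1 + w) @ (0 : F) --> w.
    have -> : (fun h : F => h *: 1 + w) = fun h => w + h * 1.
      by apply/funext => h; rewrite addrC.
    have [+ _] := is_derive1_affine w 1 0.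
    by move=> /derivable_continuous_at; rewrite /prop_for /continuous_at mul0r addr0.
  move=> /(_ _ near_w) /=; apply: (@filterS F (nbhs (0 : F))) => h [-> ].
  by rewrite addrK [h *: 1]mulr1.
have kcvg : (fun h : F => S (h *: 1 + w) - t) @ 0^' --> (0 : F)^'.
  move=> P [e /= e0 He]; apply: filter_app near0; exists (K * e) => /=; first exact: mulr_gt0.
  move=> h; rewrite /= sub0r normrN => hKe [TS Kh] h0; apply: He => /=.
    by rewrite sub0r normrN -(ltr_pM2l K0); exact: le_lt_trans hKe.
  apply/eqP => /eqP; rewrite subr_eq0 => /eqP St; move: TS; rewrite St Tt => /eqP.
  by rewrite addrC -subr_eq0 opprD addrA subrr sub0r oppr_eq0 [h *: 1]mulr1 (negPf h0).
have H : (fun h : F => h^-1 *: ((S \o shift w) (h *: 1) - S w)) @ 0^' --> a^-1.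
  have := cvg_comp _ _ kcvg dT; rewrite -/(derive T t 1) Ta => /(cvgV a0).
  apply: cvg_trans; apply: near_eq_cvg; apply: filter_app (nbhs_dnbhs near0).
  apply: filterE => h [TS _] /=.
  rewrite Sw [(S _ - t) *: 1]mulr1 subrK TS Tt addrK -[_ *: (h *: 1)]/(_ * _).
  by rewrite [h *: 1]mulr1 invfM invrK mulrC.
by split; [apply/cvg_ex; eexists; exact: H|exact: cvg_lim H].
Qed.

(* On a ball where [|T' - c| <= |c|/2], the map [T] is expanding up to the
   factor [|c|/2]; a point minimising [|T - w|] solves [T z = w], since the
   Newton step [z - (T z - w)/c] at least halves [|T - w|]. *)
Lemma local_inverse (D : set F) (T : F -> F) (t0 : F) :
  open D -> smooth D T -> D t0 -> T^`() t0 != 0 ->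
  exists (U : set F) (S : F -> F),
    [/\ [/\ open U, U t0 & U `<=` D], open (T @` U),
        forall t, U t -> S (T t) = t & smooth (T @` U) S].
Proof.
move=> oD sT Dt0 T'0; set c := T^`() t0 in T'0 *; pose k := `|c| / 2.
have k0 : 0 < k by rewrite divr_gt0 ?normr_gt0.
have kk : k + k = `|c| by rewrite -splitr.
have [e /= e0 He] : exists2 e : F, 0 < e & forall z, `|t0 - z| < e ->
    D z /\ `|c - T^`()%classic z| < k.
  have : \forall z \near t0, D z /\ `|c - T^`()%classic z| < k.
    apply: filterI; first exact: open_near.
    have dT' : derivable T^`() t0 1 := smooth_derive1 sT (n := 0%N) Dt0.
    exact: (continuous_ball (derivable_continuous_at dT') k0).
  by move=> /nbhs_ballP[e e0 He]; exists e.
pose U := [set z | `|t0 - z| < e].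
have oU : open U.
  apply: openP => z Uz; exists (e - `|t0 - z|); first by rewrite subr_gt0.
  by move=> w; rewrite ltrBrDl; apply: le_lt_trans; exact: ler_distD.
have Td z : U z -> is_derive z 1 T (T^`() z).
  by move=> /He[Dz _]; exact: smooth_is_derive Dz.
(* The mean value inequality is applied to T z - c z, whose derivative has norm below k on the
   ball. *)
have near_lin z w : U z -> U w -> `|T z - T w - c * (z - w)| <= k * `|z - w|.
  move=> Uz Uw.
  have -> : T z - T w - c * (z - w) = (T z + z * - c) - (T w + w * - c) by ring.
  apply: (mvi (f := fun z => T z + z * - c) (a := t0) (e := e)) => // y Uy.
  have hd : is_derive y 1 (fun z => T z + z * - c) (T^`()%classic y - c).
    have := is_derive1D (Td y Uy) (is_derive1_affine 0 (- c) y).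
    by under [X in is_derive _ _ X]funext do rewrite add0r.
  split; first by case: hd.
  by rewrite (is_derive_derive1 hd) distrC; have [_ /ltW] := He y Uy.
have expand z w : U z -> U w -> k * `|z - w| <= `|T z - T w|.
  move=> Uz Uw; have := near_lin z w Uz Uw; rewrite distrC => /(le_trans (lerB_dist _ _)).
  by rewrite lerBlDr normrM -kk mulrDl lerD2l.
have inj z w : U z -> U w -> T z = T w -> z = w.
  move=> Uz Uw Tzw; have := expand z w Uz Uw; rewrite Tzw subrr normr0.
  by rewrite pmulr_rle0 // normr_le0 subr_eq0 => /eqP.
have T'n0 z : U z -> T^`() z != 0.
  move=> /He[_]; apply: contraTN => /eqP ->; rewrite subr0 -kk.
  by rewrite -[ltRHS]addr0 ltrD2l lt_gtF.
have oTU : open (T @` U).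
  apply: openP => _ [z0 Uz0 <-].
  have [d d0 Hd] := open_ballP oU Uz0.
  pose r := d / 2; have r0 : 0 < r by rewrite divr_gt0.
  have rd : r + r = d by rewrite -splitr.
  have subU z : `|z0 - z| <= r -> U z.
    by move=> zr; apply: Hd; apply: le_lt_trans zr _; rewrite -rd ltrDl.
  (* With this radius, k times the distance from z0 to the Newton step [s'] is at most three
     quarters of k r, so [s'] stays in the closed ball on which s is minimal. *)
  exists (k * (r / 4)); first by apply: mulr_gt0 => //; exact: divr_gt0.
  move=> w wd.
  have [|s s_r smin] := nam (f := fun z => T z - w) (a := z0) (ltW r0).
    move=> z /subU Uz; apply: derivable_continuous_at.
    have := is_derive1D (Td z Uz) (is_derive_cst (- w) z 1).
    by case.
  have Us := subU s s_r.
  have N_M : `|T s - w| <= `|T z0 - w| by apply: smin; rewrite subrr normr0 ltW.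
  have Nd : `|T s - w| < k * (r / 4) by exact: le_lt_trans wd.
  exists s => //; apply/eqP; rewrite -subr_eq0 -normr_le0.
  pose s' := s - (T s - w) / c.
  have ss' : k * `|s' - s| = `|T s - w| / 2.
    rewrite /s' addrAC subrr sub0r normrN normrM normfV /k.
    by field; rewrite normr_eq0.
  have Us' : `|z0 - s'| <= r.
    have -> : z0 - s' = (z0 - s) - (s' - s) by ring.
    apply: le_trans (ler_normB _ _) _; rewrite -(ler_pM2l k0) mulrDr ss'.
    apply: le_trans (lerD (expand z0 s Uz0 Us) (lexx _)) _.
    have -> : T z0 - T s = (T z0 - w) - (T s - w) by ring.
    apply: le_trans (lerD (ler_normB _ _) (lexx _)) _.
    apply: le_trans (lerD (lerD (ltW wd) (ltW Nd)) (_ : _ <= k * (r / 4))) _.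
      apply: le_trans (ltW Nd); rewrite ler_pdivrMr // ler_peMr //.
      by rewrite ler1n.
    have -> : k * (r / 4) + k * (r / 4) + k * (r / 4) = k * r - k * (r / 4) by field.
    by rewrite lerBlDr lerDl; apply: mulr_ge0; rewrite ?divr_ge0 // ltW.
  have := smin s' Us'.
  have -> : T s' - w = T s' - T s - c * (s' - s) by rewrite /s'; field.
  move=> /le_trans /(_ (near_lin s' s (subU _ Us') Us)); rewrite ss' => H.
  have : `|T s - w| / 2 <= 0.
    by rewrite -(lerD2l (`|T s - w| / 2)) addr0 -splitr.
  by rewrite pmulr_lle0 ?invr_gt0.
(* Outside the image of U the value is the default t0; only values on the image are used. *)
pose S w := xget t0 [set s | U s /\ T s = w].
have SP w : (T @` U) w -> U (S w) /\ T (S w) = w.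
  by move=> [s Us Ts]; apply: (@xgetPex _ t0 [set s | U s /\ T s = w]); exists s.
have ST t : U t -> S (T t) = t.
  move=> Ut; have [US TS] : U (S (T t)) /\ T (S (T t)) = T t by apply: SP; exists t.
  exact: inj.
have sTU : smooth U T by apply: smooth_sub sT => z /He[].
exists U, S; split=> //; first by split=> // [|z /He[]//]; rewrite /U /= subrr normr0.
apply: (smooth_inverse oTU oU (fun w wTU => (SP w wTU).1) sTU T'n0) => w wTU.
have [US TS] := SP w wTU.
apply: (expanding_derivable_inverse k0 (Td _ US) (T'n0 _ US)) => //.
apply: filterS (open_near oTU wTU) => v /SP[Uv Tv]; split=> //.
by have := expand _ _ Uv US; rewrite Tv TS.
Qed.

End InverseFunction.

(** * Total derivatives of rational functions on the jet space *)

Section SmoothTwo.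
Variable F : numFieldType.
Implicit Types (W : set (F * F)) (f g : F * F -> F).

(** [foldr] applies the last letter of a word first, so a derivative taken before all others is a
    letter appended at the end. *)
Lemma smooth2_partial_t W f : smooth2 W f -> smooth2 W (partial_t f).
Proof.
move=> sf w p /(sf (rcons w false)).
by rewrite /iterated_partial foldr_rcons.
Qed.

Lemma smooth2_partial_x W f : smooth2 W f -> smooth2 W (partial_x f).
Proof.
move=> sf w p /(sf (rcons w true)).
by rewrite /iterated_partial foldr_rcons.
Qed.

Lemma differentiable_is_derive_t f (t x : F) : differentiable f (t, x) ->
  is_derive t 1 (fun s => f (s, x)) (partial_t f (t, x)).
Proof.
move=> df; apply: derivable_is_derive; apply/derivable1_diffP.
by apply: (@differentiable_comp _ _ _ _ (fun s : F => (s, x)) f).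
Qed.

Lemma differentiable_is_derive_x f (t x : F) : differentiable f (t, x) ->
  is_derive x 1 (fun s => f (t, s)) (partial_x f (t, x)).
Proof.
move=> df; apply: derivable_is_derive; apply/derivable1_diffP.
by apply: (@differentiable_comp _ _ _ _ (fun s : F => (t, s)) f).
Qed.

Lemma smooth2_differentiable W f p : smooth2 W f -> W p -> differentiable f p.
Proof. by move=> sf /(sf [::]). Qed.

Lemma open_near_t W (t x : F) : open W -> W (t, x) -> \forall s \near t, W (s, x).
Proof.
move=> oW Wtx; have dc : differentiable (fun s : F => (s, x)) t by [].
by have := differentiable_continuous dc (open_nbhs_nbhs (conj oW Wtx)).
Qed.

Lemma open_near_x W (t x : F) : open W -> W (t, x) -> \forall s \near x, W (t, s).
Proof.
move=> oW Wtx; have dc : differentiable (fun s : F => (t, s)) x by [].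
by have := differentiable_continuous dc (open_nbhs_nbhs (conj oW Wtx)).
Qed.

End SmoothTwo.

Section Slots.
Variable F : numFieldType.
Implicit Types (g h : jet_fun F) (t s : F) (y : nat -> F).

(* [None] stands for the variable t and [Some j] for the variable x^(j). *)
Definition slot_point (i : option nat) t y : F := if i is Some j then y j else t.
Definition slot_t (i : option nat) t s : F := if i is Some _ then t else s.
Definition slot_y (i : option nat) y s : nat -> F :=
  if i is Some j then [eta y with j |-> s] else y.

Definition jderiv (i : option nat) g : jet_fun F := fun t y =>
  (fun s => g (slot_t i t s) (slot_y i y s))^`() (slot_point i t y).

Lemma slot_t_id i t y : slot_t i t (slot_point i t y) = t.
Proof. by case: i. Qed.

Lemma slot_y_id i t y : slot_y i y (slot_point i t y) = y.
Proof. by case: i => // j; apply/funext => k /=; case: eqP => // ->. Qed.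

Lemma total_derivE n g t y : total_deriv n g t y =
  jderiv None g t y + \sum_(j < n.+1) y j.+1 * jderiv (Some (j : nat)) g t y.
Proof. by []. Qed.

End Slots.

Section JetPolynomials.
Variables (F : numFieldType) (W : set (F * F)) (Om : F -> (nat -> F) -> Prop).
Implicit Types (f : F * F -> F) (g h : jet_fun F) (t s : F) (y : nat -> F).

(* Functions of order at most [n] built rationally from the jet coordinates and
   smooth functions of (t, x); [Om] is the domain on which they are considered. *)
Inductive jet_rational (n : nat) : jet_fun F -> Prop :=
| jet_base f : smooth2 W f -> jet_rational n (fun t y => f (t, y 0%N))
| jet_cst c : jet_rational n (fun _ _ => c)
| jet_coord j : (j <= n)%N -> jet_rational n (fun _ y => y j)
| jet_add g h : jet_rational n g -> jet_rational n h ->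
    jet_rational n (fun t y => g t y + h t y)
| jet_mul g h : jet_rational n g -> jet_rational n h ->
    jet_rational n (fun t y => g t y * h t y)
| jet_inv g : jet_rational n g -> (forall t y, Om t y -> g t y != 0) ->
    jet_rational n (fun t y => (g t y)^-1)
| jet_eq g h : jet_rational n g -> (forall t y, Om t y -> g t y = h t y) ->
    jet_rational n h.

Lemma jet_weaken n m g : (n <= m)%N -> jet_rational n g -> jet_rational m g.
Proof.
move=> nm; elim=> {g}.
- exact: jet_base.
- exact: jet_cst.
- by move=> j jn; apply: jet_coord; exact: leq_trans nm.
- by move=> g h _ Hg _ Hh; exact: jet_add.
- by move=> g h _ Hg _ Hh; exact: jet_mul.
- by move=> g _ Hg g0; exact: jet_inv.
- by move=> g h _ Hg gh; exact: jet_eq gh.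
Qed.

Lemma jet_dep n g t y y' : jet_rational n g -> Om t y -> Om t y' ->
  (forall j, (j <= n)%N -> y j = y' j) -> g t y = g t y'.
Proof.
move=> + Oy Oy' yy'; elim=> {g} //=.
- by move=> f _; rewrite yy'.
- by move=> g h _ -> _ ->.
- by move=> g h _ -> _ ->.
- by move=> g _ -> _.
- by move=> g h _ gyy' gh; rewrite -!gh.
Qed.

Lemma jet_exp n g k : jet_rational n g -> jet_rational n (fun t y => g t y ^+ k).
Proof.
move=> ng; elim: k => [|k IH]; first exact: jet_cst.
by apply: jet_eq (jet_mul ng IH) _ => t y _; rewrite exprS.
Qed.

Lemma jet_sum n (s : seq nat) (g : nat -> jet_fun F) :
  (forall i, i \in s -> jet_rational n (g i)) ->
  jet_rational n (fun t y => \sum_(i <- s) g i t y).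
Proof.
elim: s => [|i s IH] H.
  by apply: jet_eq (jet_cst n 0) _ => t y _; rewrite big_nil.
have Hs : jet_rational n (fun t y => \sum_(i <- s) g i t y).
  by apply: IH => j js; apply: H; rewrite inE js orbT.
have Hi : jet_rational n (g i) by apply: H; rewrite inE eqxx.
by apply: jet_eq (jet_add Hi Hs) _ => t y _; rewrite big_cons.
Qed.

(** Since t and x stay fixed along the curve, functions of (t, x) are constant on it. This supplies
    the continuity for the limit in which [DT P] tends to 0. *)
Lemma jet_curve_derivable n g t (c : F -> nat -> F) s0 : jet_rational n g ->
  (forall s, c s 0%N = c s0 0%N) -> W (t, c s0 0%N) ->
  (\forall s \near s0, Om t (c s)) ->
  (forall j, (j <= n)%N -> derivable (fun s => c s j) s0 1) ->
  derivable (fun s => g t (c s)) s0 1.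
Proof.
move=> + c0 Wc Oc dc; elim=> {g}.
- move=> f _; under [X in derivable X]funext do rewrite c0.
  exact: derivable_cst.
- by move=> k; exact: derivable_cst.
- by move=> j jn; exact: dc.
- by move=> g h _ dg _ dh; exact: (derivableD dg dh).
- by move=> g h _ dg _ dh; exact: (derivableM dg dh).
- move=> g _ dg g0; apply: derivableV dg; apply: g0; exact: nbhs_singleton Oc.
- move=> g h _ dg gh; apply: near_eq_derivable dg.
  by apply: filterS Oc => s; exact: gh.
Qed.

Hypothesis OmW : forall t y, Om t y -> W (t, y 0%N).
Hypothesis Om_open : forall i t y, Om t y ->
  \forall s \near slot_point i t y, Om (slot_t i t s) (slot_y i y s).

Lemma jderiv_eq i g h t y : (forall t y, Om t y -> g t y = h t y) -> Om t y ->
  jderiv i g t y = jderiv i h t y.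
Proof.
move=> gh Oty; apply: near_eq_derive1; apply: filterS (Om_open i Oty) => s.
exact: gh.
Qed.

Lemma jderiv_base f t y : W (t, y 0%N) -> 
  [/\ jderiv None (fun t y => f (t, y 0%N)) t y = partial_t f (t, y 0%N),
      jderiv (Some 0%N) (fun t y => f (t, y 0%N)) t y = partial_x f (t, y 0%N) &
      forall j, jderiv (Some j.+1) (fun t y => f (t, y 0%N)) t y = 0].
Proof. by move=> Wty; split=> // j; rewrite /jderiv /= derive1_cst. Qed.

Lemma jderiv_cst i c t y : jderiv i (fun _ _ => c) t y = 0.
Proof. by rewrite /jderiv derive1_cst. Qed.

Lemma jderiv_coord i j t y : jderiv i (fun _ y => y j) t y = (i == Some j)%:R.
Proof.
rewrite /jderiv; case: i => [k|] /=; last by rewrite derive1_cst.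
rewrite -[Some k == Some j]/(k == j) [j == k]eq_sym; case: (k == j).
  exact: (is_derive_derive1 (is_derive_id (y k) (1 : F))).
by rewrite derive1_cst.
Qed.

Lemma jet_is_derive n g i t y : jet_rational n g -> Om t y ->
  is_derive (slot_point i t y) 1 (fun s => g (slot_t i t s) (slot_y i y s))
    (jderiv i g t y).
Proof.
move=> + Oty; suff: jet_rational n g ->
    derivable (fun s => g (slot_t i t s) (slot_y i y s)) (slot_point i t y) 1.
  by move=> H /H; exact: derivable_is_derive.
elim=> {g}.
- move=> f sf; have df := smooth2_differentiable sf (OmW Oty).
  case: i => [[|j]|] /=; last 1 first.
  + by have [] := differentiable_is_derive_t df.
  + by have [] := differentiable_is_derive_x df.
  + exact: derivable_cst.
- by move=> c; exact: derivable_cst.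
- move=> j _; case: i => [k|] /=; last exact: derivable_cst.
  by case: (j == k); [exact: derivable_id|exact: derivable_cst].
- by move=> g h _ dg _ dh; exact: (derivableD dg dh).
- by move=> g h _ dg _ dh; exact: (derivableM dg dh).
- by move=> g _ dg g0; apply: derivableV dg; rewrite slot_t_id slot_y_id; exact: g0.
- move=> g h _ dg gh; apply: near_eq_derivable dg.
  by apply: filterS (Om_open i Oty) => s; exact: gh.
Qed.

Lemma jderivD n m g h i t y : jet_rational n g -> jet_rational m h -> Om t y ->
  jderiv i (fun t y => g t y + h t y) t y = jderiv i g t y + jderiv i h t y.
Proof.
move=> ng mh Oty; apply: is_derive_derive1.
exact: is_derive1D (jet_is_derive i ng Oty) (jet_is_derive i mh Oty).
Qed.

Lemma jderivM n m g h i t y : jet_rational n g -> jet_rational m h -> Om t y ->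
  jderiv i (fun t y => g t y * h t y) t y =
  jderiv i g t y * h t y + g t y * jderiv i h t y.
Proof.
move=> ng mh Oty; apply: is_derive_derive1.
have := is_derive1M (jet_is_derive i ng Oty) (jet_is_derive i mh Oty).
by rewrite slot_t_id slot_y_id.
Qed.

Lemma jderivV n g i t y : jet_rational n g -> (forall t y, Om t y -> g t y != 0) ->
  Om t y ->
  jderiv i (fun t y => (g t y)^-1) t y = - jderiv i g t y / g t y ^+ 2.
Proof.
move=> ng g0 Oty; apply: is_derive_derive1.
have := is_derive1V _ (jet_is_derive i ng Oty); rewrite slot_t_id slot_y_id.
by apply; exact: g0.
Qed.

Lemma jet_jderiv n g i : jet_rational n g -> jet_rational n (jderiv i g).
Proof.
elim=> {g}.
- move=> f sf; case: i => [[|j]|].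
  + exact: (jet_base n (smooth2_partial_x sf)).
  + apply: jet_eq (jet_cst n 0) _ => t y Oty.
    by have [_ _ ->] := jderiv_base f (OmW Oty).
  + exact: (jet_base n (smooth2_partial_t sf)).
- by move=> c; apply: jet_eq (jet_cst n 0) _ => t y _; rewrite jderiv_cst.
- move=> j _; apply: jet_eq (jet_cst n (i == Some j)%:R) _ => t y _.
  by rewrite jderiv_coord.
- move=> g h ng dg nh dh; apply: jet_eq (jet_add dg dh) _ => t y Oty.
  by rewrite (jderivD i ng nh).
- move=> g h ng dg nh dh.
  apply: jet_eq (jet_add (jet_mul dg nh) (jet_mul ng dh)) _ => t y Oty.
  by rewrite (jderivM i ng nh).
- move=> g ng dg g0.
  have ng2 := jet_exp 2 (jet_inv ng g0).
  apply: jet_eq (jet_mul (jet_mul (jet_cst n (-1)) dg) ng2) _ => t y Oty.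
  by rewrite (jderivV i ng g0) // mulN1r exprVn.
- move=> g h _ dg gh; apply: jet_eq dg _ => t y; exact: jderiv_eq.
Qed.

Lemma jderiv_high n g j t y : jet_rational n g -> (n < j)%N -> Om t y ->
  jderiv (Some j) g t y = 0.
Proof.
move=> ng nj Oty; rewrite -(jderiv_cst (Some j) (g t y) t y).
apply: near_eq_derive1; apply: filterS (Om_open (Some j) Oty) => s Os.
apply: (jet_dep ng Os Oty) => k kn /=; case: eqP => // kj.
by move: kn; rewrite kj leqNgt nj.
Qed.

Lemma jet_total_deriv n g : jet_rational n g -> jet_rational n.+1 (total_deriv n g).
Proof.
move=> ng; pose T t y := \sum_(j <- iota 0 n.+1) y j.+1 * jderiv (Some j) g t y.
have nT : jet_rational n.+1 T.
  apply: jet_sum => j; rewrite mem_iota /= add0n => jn; apply: jet_mul.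
    exact: jet_coord.
  by apply: jet_weaken (leqnSn n) _; exact: jet_jderiv.
have nt := jet_weaken (leqnSn n) (jet_jderiv None ng).
apply: jet_eq (jet_add nt nT) _ => t y _.
by rewrite /T -[iota _ _]/(index_iota 0 n.+1) big_mkord.
Qed.

(** The extra summands differentiate in coordinates on which g does not depend. Functions of
    different orders can thus be differentiated with a common truncation. *)
Lemma total_deriv_stable n m g t y : jet_rational n g -> (n <= m)%N -> Om t y ->
  total_deriv m g t y = total_deriv n g t y.
Proof.
move=> ng nm Oty; rewrite !total_derivE; congr (_ + _).
rewrite -!(big_mkord xpredT (fun j => y j.+1 * jderiv (Some j) g t y)).
have H0 : \sum_(n.+1 <= j < m.+1) y j.+1 * jderiv (Some j) g t y = 0.
  rewrite big_nat_cond big1 // => j; rewrite andbT => /andP[nj _].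
  by rewrite (jderiv_high ng nj) ?mulr0.
by rewrite (@big_cat_nat _ _ _ n.+1) //= H0 addr0.
Qed.

Lemma total_deriv_eq n g h t y : (forall t y, Om t y -> g t y = h t y) -> Om t y ->
  total_deriv n g t y = total_deriv n h t y.
Proof.
move=> gh Oty; rewrite !total_derivE (jderiv_eq _ gh) //; congr (_ + _).
by apply: eq_bigr => j _; rewrite (jderiv_eq _ gh).
Qed.

Lemma total_deriv_base n f t y : Om t y ->
  total_deriv n (fun t y => f (t, y 0%N)) t y =
  partial_t f (t, y 0%N) + y 1%N * partial_x f (t, y 0%N).
Proof.
move=> Oty; have [ft fx f0] := jderiv_base f (OmW Oty).
rewrite total_derivE ft big_ord_recl fx big1 ?addr0 // => j _.
by rewrite f0 mulr0.
Qed.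

Lemma total_deriv_cst n c t y : total_deriv n (fun _ _ => c) t y = 0.
Proof.
by rewrite total_derivE jderiv_cst big1 ?addr0 // => j _; rewrite jderiv_cst mulr0.
Qed.

Lemma total_deriv_coord n j t y : (j <= n)%N ->
  total_deriv n (fun _ y => y j) t y = y j.+1.
Proof.
move=> jn; rewrite total_derivE jderiv_coord add0r (bigD1 (inord j)) //=.
rewrite jderiv_coord inordK // eqxx mulr1 big1 ?addr0 // => k kj.
rewrite jderiv_coord -[Some _ == _]/(k == j :> nat); case: eqP => [kj'|]; last by rewrite mulr0.
by move/eqP: kj; case; apply/val_inj; rewrite /= inordK.
Qed.

Lemma total_derivD n a b g h t y : jet_rational a g -> jet_rational b h -> Om t y ->
  total_deriv n (fun t y => g t y + h t y) t y =
  total_deriv n g t y + total_deriv n h t y.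
Proof.
move=> ag bh Oty; rewrite !total_derivE (jderivD _ ag bh) // addrACA -big_split.
congr (_ + _); apply: eq_bigr => j _; by rewrite (jderivD _ ag bh) // mulrDr.
Qed.

Lemma total_derivM n a b g h t y : jet_rational a g -> jet_rational b h -> Om t y ->
  total_deriv n (fun t y => g t y * h t y) t y =
  total_deriv n g t y * h t y + g t y * total_deriv n h t y.
Proof.
move=> ag bh Oty; rewrite !total_derivE (jderivM _ ag bh) // mulrDl mulrDr.
rewrite addrACA big_distrl big_distrr -big_split /=; congr (_ + _).
apply: eq_bigr => j _; rewrite (jderivM _ ag bh) // mulrDr mulrA; congr (_ + _).
exact: mulrCA.
Qed.

Lemma total_derivV n a g t y : jet_rational a g ->
  (forall t y, Om t y -> g t y != 0) -> Om t y ->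
  total_deriv n (fun t y => (g t y)^-1) t y = - total_deriv n g t y / g t y ^+ 2.
Proof.
move=> ag g0 Oty; rewrite !total_derivE (jderivV _ ag g0) // opprD mulrDl.
congr (_ + _); rewrite -sumrN big_distrl; apply: eq_bigr => j _ /=.
by rewrite (jderivV _ ag g0) // !mulrA mulrN.
Qed.

End JetPolynomials.

(** * Domains in the jet space *)

Section JetDomains.
Variables (F : numFieldType) (W : set (F * F)).
Implicit Types (Om : F -> (nat -> F) -> Prop) (g h : jet_fun F) (t : F) (y : nat -> F).

(** Openness is required along each coordinate line only, which is what partial derivatives see; no
    topology on the infinite jets y is involved. *)
Definition jet_open Om := forall i t y, Om t y ->
  \forall s \near slot_point i t y, Om (slot_t i t s) (slot_y i y s).

Lemma jet_restrict Om Om' n g : (forall t y, Om' t y -> Om t y) ->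
  jet_rational W Om n g -> jet_rational W Om' n g.
Proof.
move=> sub; elim=> {g}.
- exact: jet_base.
- exact: jet_cst.
- exact: jet_coord.
- by move=> g h _ ng _ nh; exact: jet_add ng nh.
- by move=> g h _ ng _ nh; exact: jet_mul ng nh.
- by move=> g _ ng g0; apply: jet_inv ng _ => t y /sub; exact: g0.
- by move=> g h _ ng gh; apply: jet_eq ng _ => t y /sub; exact: gh.
Qed.

Lemma jet_open_base : open W -> jet_open (fun t y => W (t, y 0%N)).
Proof.
move=> oW [[|j]|] t y Wty /=; first exact: open_near_x.
  exact: filterE.
exact: open_near_t.
Qed.

Lemma jet_open_neq0 Om n g : (forall t y, Om t y -> W (t, y 0%N)) -> jet_open Om ->
  jet_rational W Om n g -> jet_open (fun t y => Om t y /\ g t y != 0).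
Proof.
move=> OmW oOm ng i t y [Oty g0]; apply: filterI; first exact: oOm.
have [dg _] := jet_is_derive OmW oOm i ng Oty.
have g0' : 0 < `|g t y| by rewrite normr_gt0.
have := continuous_ball (derivable_continuous_at dg) g0'.
apply: filterS => s; rewrite slot_t_id slot_y_id; apply: contraTN => /eqP ->.
by rewrite subr0 ltxx.
Qed.

Lemma total_derivX Om n a g k t y : (forall t y, Om t y -> W (t, y 0%N)) ->
  jet_open Om -> jet_rational W Om a g -> Om t y ->
  total_deriv n (fun t y => g t y ^+ k) t y =
  k%:R * g t y ^+ k.-1 * total_deriv n g t y.
Proof.
move=> OmW oOm ag Oty; elim: k => [|k IH].
  by rewrite !mul0r -[LHS]/(total_deriv n (fun _ _ => 1) t y) total_deriv_cst.
rewrite (total_deriv_eq oOm n (h := fun t y => g t y * g t y ^+ k)) //; last first.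
  by move=> s z _; rewrite exprS.
rewrite (total_derivM OmW oOm n ag (jet_exp k ag)) // IH /=.
case: k {IH} => [|k] /=; first by rewrite expr0; ring.
by rewrite exprS -[in RHS]natr1; ring.
Qed.

End JetDomains.

(** * Determining equations for T and X *)

Section IndependentVariable.
Variables (F : numFieldType) (P : transf F).
Local Notation W := (tdom P).
Local Notation over_dom := (fun t y => W (t, y 0%N)).
Local Notation T_t := (partial_t (tT P)).
Local Notation T_x := (partial_x (tT P)).
Implicit Types (t x : F) (y : nat -> F).

Hypothesis ptP : point_transformation P.

Let oW : open W. Proof. by have [[]] := ptP. Qed.
Let sT : smooth2 W (tT P). Proof. by case: ptP. Qed.
Let sX : smooth2 W (tX P). Proof. by case: ptP. Qed.
Let sub (t : F) (y : nat -> F) : over_dom t y -> W (t, y 0%N). Proof. by []. Qed.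
Let oO : jet_open over_dom. Proof. exact: jet_open_base. Qed.

(* [prolong P k.+1] is the quotient of this polynomial by [DT P ^+ (2 * k + 1)];
   unlike the quotient, it makes sense where [DT P] vanishes. *)
Fixpoint prolong_num k : jet_fun F :=
  if k is k'.+1 then fun t y =>
    total_deriv k (prolong_num k') t y * DT P t y
      - (2 * k' + 1)%:R * prolong_num k' t y * total_deriv 1 (DT P) t y
  else total_deriv 0 (fun t y => tX P (t, y 0%N)).

Lemma jet_DT : jet_rational W over_dom 1 (DT P).
Proof. exact: (jet_total_deriv sub oO (jet_base _ 0 sT)). Qed.

Lemma DTE t y : W (t, y 0%N) -> DT P t y = T_t (t, y 0%N) + y 1%N * T_x (t, y 0%N).
Proof. exact: (total_deriv_base sub). Qed.

Lemma jet_prolong_num k : jet_rational W over_dom k.+1 (prolong_num k).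
Proof.
elim: k => [|k IH] /=; first exact: (jet_total_deriv sub oO (jet_base _ 0 sX)).
have nD : jet_rational W over_dom k.+2 (DT P) by exact: jet_weaken jet_DT.
have nDD : jet_rational W over_dom k.+2 (total_deriv 1 (DT P)).
  by apply: (jet_weaken (n := 2)) => //; exact: jet_total_deriv jet_DT.
have nN := jet_weaken (leqnSn k.+1) IH.
apply: jet_eq (jet_add (jet_mul (jet_total_deriv sub oO IH) nD)
  (jet_mul (jet_mul (jet_cst _ _ _ (- (2 * k + 1)%:R)) nN) nDD)) _ => t y _.
by rewrite !mulNr.
Qed.

(** With N the numerator, D = [DT P] and m = 2 k + 1, the quotient rule gives D_t (N / D^m) / D =
    (D_t N D - m N D_t D) / D^(m+2): each step raises the exponent by two. *)
Lemma prolong_numE k t y : W (t, y 0%N) -> DT P t y != 0 ->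
  prolong P k.+1 t y = prolong_num k t y / DT P t y ^+ (2 * k + 1).
Proof.
pose Om t y := over_dom t y /\ DT P t y != 0.
have OmO t' y' : Om t' y' -> over_dom t' y' by case.
have oOm : jet_open Om := jet_open_neq0 sub oO jet_DT.
have jD : jet_rational W Om 1 (DT P) := jet_restrict OmO jet_DT.
have D0 t' y' : Om t' y' -> DT P t' y' != 0 by case.
move=> Wty DTty; have : Om t y by [].
elim: k t y {Wty DTty} => [|k IH] t y Oty; first by rewrite expr1.
have jN : jet_rational W Om k.+1 (prolong_num k) := jet_restrict OmO (jet_prolong_num k).
have jDX : jet_rational W Om 1 (fun t y => DT P t y ^+ (2 * k + 1)) by exact: jet_exp.
have DX0 t' y' : Om t' y' -> DT P t' y' ^+ (2 * k + 1) != 0.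
  by move=> /D0 d0; exact: expf_neq0.
rewrite -[LHS]/(total_deriv k.+1 (prolong P k.+1) t y / DT P t y).
rewrite (total_deriv_eq oOm _ (h := fun t y =>
  prolong_num k t y * (DT P t y ^+ (2 * k + 1))^-1)) //.
rewrite (total_derivM OmO oOm _ jN (jet_inv jDX DX0)) //.
rewrite (total_derivV OmO oOm _ jDX DX0) // (total_derivX _ _ OmO oOm jD) //.
rewrite [total_deriv k.+1 (DT P) t y](total_deriv_stable oOm jD) //=.
have -> : (2 * k.+1 + 1 = (2 * k + 1).+2)%N by rewrite mulnS.
rewrite [(2 * k + 1).-1](_ : _ = 2 * k)%N ?addn1 //= !exprS.
have d0 := D0 _ _ Oty; field.
by rewrite expf_neq0 // d0.
Qed.

(** Where [DT P] vanishes, the recursion keeps only its second term, a product of nonzero factors in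
    characteristic 0. *)
Lemma prolong_num_neq0 k t y : DT P t y = 0 -> total_deriv 1 (DT P) t y != 0 ->
  prolong_num 0 t y != 0 -> prolong_num k t y != 0.
Proof.
move=> D0 DD0 N0; elim: k => // k IH /=.
by rewrite D0 mulr0 sub0r oppr_eq0 !mulf_neq0 // pnatr_eq0 addn1.
Qed.

Lemma DDTE t y : W (t, y 0%N) -> total_deriv 1 (DT P) t y =
  partial_t T_t (t, y 0%N) + y 1%N * partial_x T_t (t, y 0%N)
  + y 1%N * (partial_t T_x (t, y 0%N) + y 1%N * partial_x T_x (t, y 0%N))
  + y 2%N * T_x (t, y 0%N).
Proof.
move=> Wty.
have jt := jet_base over_dom 0 (smooth2_partial_t sT).
have jx := jet_base over_dom 1 (smooth2_partial_x sT).
have j1 : jet_rational W over_dom 1 (fun _ y => y 1%N) by exact: jet_coord.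
rewrite (total_deriv_eq oO 1 (h := fun t y =>
  T_t (t, y 0%N) + y 1%N * T_x (t, y 0%N))) //; last exact: DTE.
rewrite (total_derivD sub oO 1 jt (jet_mul j1 jx)) // (total_derivM sub oO 1 j1 jx) //.
rewrite (total_deriv_base sub 1 T_t) // (total_deriv_base sub 1 T_x) //.
by rewrite total_deriv_coord // [X in _ + X = _]addrC addrA.
Qed.

Lemma eq0_of_punctured (g : F -> F) s0 : derivable g s0 1 ->
  (forall s, s != s0 -> g s = 0) -> g s0 = 0.
Proof.
move=> dg g0; apply/eqP/negP => /negP gn0.
have : 0 < `|g s0| by rewrite normr_gt0.
move=> /(continuous_ball (derivable_continuous_at dg)) /nbhs_ballP[e /= e0 He].
have : `|g s0 - g (s0 + e / 2)| < `|g s0|.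
  apply: He; rewrite /ball /= opprD addrA subrr sub0r normrN gtr0_norm ?divr_gt0 //.
  by rewrite ltr_pdivrMr // ltr_pMr // ltr1n.
have sn : s0 + e / 2 != s0.
  by rewrite -subr_eq0 addrAC subrr add0r mulf_neq0 ?invr_eq0 ?pnatr_eq0 ?gt_eqF.
by rewrite (g0 _ sn) subr0 ltxx.
Qed.

Variables (r : nat) (E Et : ode F).
Hypothesis r3 : (3 <= r)%N.
Hypothesis PE : maps_ode r E Et P.

(* If [T_x] did not vanish at (t, x), then along the jets of [E] over (t, x) one
   could let [DT P] tend to 0 while [D_t (DT P)] stays equal to 1, because
   [x^(2)] is free when [r >= 3]; the equation [Et] would force the numerator of
   the prolongation of order [r] to vanish in the limit. *)
Lemma maps_ode_Tx0 t x : W (t, x) -> T_x (t, x) = 0.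
Proof.
move=> Wtx; apply/eqP/negP => /negP Tx0.
(* This is the value of x^(1) at which [DT P] vanishes over (t, x); [K] is the part of D_t ([DT P])
   there that is free of x^(2). *)
pose p := - T_t (t, x) / T_x (t, x).
pose K := partial_t T_t (t, x) + p * partial_x T_t (t, x)
  + p * (partial_t T_x (t, x) + p * partial_x T_x (t, x)).
(* The choice of x^(2) makes D_t ([DT P]) equal to 1 at s = p. *)
pose q (s : F) (j : nat) : F :=
  match j with 0 => x | 1 => s | 2 => (1 - K) / T_x (t, x) | _ => 0 end.
(* The coordinate x^(r) is solved from [E]; since 2 < r this leaves x, x^(1) and x^(2) as
   prescribed. *)
pose c (s : F) (j : nat) : F :=
  if j == r then rhs E t - \sum_(1 <= i < r) coef E i t * q s i else q s j.
have cq s j : (j < r)%N -> c s j = q s j by rewrite /c => jr; rewrite ltn_eqF.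
have c0 s : c s 0%N = x by rewrite cq // (leq_trans _ r3).
have c1 s : c s 1%N = s by rewrite cq // (leq_trans _ r3).
have c2 s : c s 2%N = (1 - K) / T_x (t, x) by rewrite cq.
have Wc s : W (t, c s 0%N) by rewrite c0.
have DTc s : DT P t (c s) = (s - p) * T_x (t, x).
  by rewrite DTE // c0 c1 /p; field.
have Ec s : satisfies r E t (c s).
  rewrite /satisfies {1}/c eqxx -[RHS](subrK (\sum_(1 <= i < r) coef E i t * q s i)).
  by congr (_ + _); apply: eq_big_nat => i /andP[_ ir]; rewrite cq.
pose tt := tT P (t, x).
(* This is the target equation multiplied by [DT P] to the power 2 r - 1; the term of order i has
   denominator exponent 2 i - 1, which leaves 2 (r - i). *)
pose G : jet_fun F := fun t y => prolong_num r.-1 t y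
  + (\sum_(i <- index_iota 1 r) coef Et i tt * (prolong_num i.-1 t y * DT P t y ^+ (2 * (r - i)))
     + - rhs Et tt * DT P t y ^+ (2 * r.-1 + 1)).
have r0 : (0 < r)%N by exact: leq_trans r3.
have jD : jet_rational W over_dom r (DT P) by exact: jet_weaken r0 jet_DT.
have jG : jet_rational W over_dom r G.
  have jN : jet_rational W over_dom r (prolong_num r.-1).
    by have := jet_prolong_num r.-1; rewrite prednK.
  apply: jet_add => //; apply: jet_add; last first.
    by apply: jet_mul; [exact: jet_cst|exact: jet_exp].
  apply: (@jet_sum _ _ _ _ _ (fun i t y =>
    coef Et i tt * (prolong_num i.-1 t y * DT P t y ^+ (2 * (r - i))))) => i.
  rewrite mem_index_iota => /andP[i0 ir]; apply: jet_mul; first exact: jet_cst.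
  apply: jet_mul; last exact: jet_exp.
  by have := jet_prolong_num i.-1; rewrite prednK //; apply: jet_weaken; exact: ltnW.
have sq j : smooth setT (q^~ j).
  by case: j => [|[|[|j]]]; [exact: smooth_cst openT _|exact: smooth_id openT|
    exact: smooth_cst openT _|exact: smooth_cst openT _].
have dc j s : derivable (c^~ j) s 1.
  suff : smooth setT (c^~ j) by move/(_ 0%N s); exact.
  rewrite /c; case: (j == r) => //.
  pose f s' := rhs E t + (-1) * \sum_(1 <= i < r) coef E i t * q s' i.
  apply: (@smooth_eq _ _ openT f) => [s' _|]; first by rewrite /f mulN1r.
  apply: (smoothD openT); first exact: smooth_cst openT _.
  apply: (smoothM openT); first exact: smooth_cst openT _.
  apply: (smooth_sum openT) => i _ _; apply: (smoothM openT); first exact: smooth_cst openT _.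
  exact: sq.
(* For s different from p the target equation holds and gives [G] = 0; the value at p follows by
   continuity. *)
have G0 : G t (c p) = 0.
  apply: (@eq0_of_punctured (fun s => G t (c s))).
    apply: (jet_curve_derivable jG) => //; first by move=> s; rewrite !c0.
    exact: filterE.
  move=> s sp; have d0 : DT P t (c s) != 0 by rewrite DTc mulf_neq0 // subr_eq0.
  have /(PE.2 _ _ (Wc s) d0) := Ec s; rewrite c0 -/tt /satisfies => /eqP.
  rewrite -subr_eq0 => /eqP Hr.
  have := congr1 (fun z => z * DT P t (c s) ^+ (2 * r.-1 + 1)) Hr; rewrite mul0r => <-.
  rewrite /G !mulrDl mulNr -addrA; congr (_ + (_ + _)).
    by rewrite -[in RHS](prednK r0) prolong_numE // divfK // expf_neq0.
  rewrite mulr_suml; apply: eq_big_nat => i /andP[i0 ir].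
  have -> : prolong P i t (c s) =
      prolong_num i.-1 t (c s) / DT P t (c s) ^+ (2 * i.-1 + 1).
    by rewrite -{1}(prednK i0) prolong_numE.
  rewrite -!mulrA; congr (_ * (_ * _)).
  have -> : (2 * r.-1 + 1 = 2 * i.-1 + 1 + 2 * (r - i))%N.
    lia.
  by rewrite (exprD _ (2 * i.-1 + 1)) mulKf // expf_neq0.
have DTp : DT P t (c p) = 0 by rewrite DTc subrr mul0r.
have := @prolong_num_neq0 r.-1 t (c p) DTp.
rewrite DDTE // c0 c1 c2 -/K divfK // addrC subrK oner_neq0 => /(_ isT).
have -> : prolong_num 0 t (c p) = jacobian_det P (t, x) * - (T_x (t, x))^-1.
  rewrite /= (total_deriv_base sub 0 (tX P)) // c0 c1 /p /jacobian_det; field.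
  exact: Tx0.
rewrite mulf_neq0 ?oppr_eq0 ?invr_eq0 //; last by have [_ _ _] := ptP; exact.
(* Each term of [G] other than the first carries a positive power of [DT P], so [G0] forces the
   nonzero numerator to be 0. *)
move=> /(_ isT); move: G0; rewrite /G DTp big_nat big1 => [|i /andP[i0 ir]].
  by rewrite add0r addn1 expr0n /= mulr0 addr0 => ->; rewrite eqxx.
by rewrite expr0n muln_eq0 subn_eq0 leqNgt ir /= !mulr0.
Qed.

End IndependentVariable.

(** * Functions that are constant or affine on the fibres over t *)

Section BaseFunctions.
Variables (F : numFieldType) (P : transf F).
Local Notation W := (tdom P).
Hypothesis oW : open W.
Implicit Types (f : F * F -> F) (g : F -> F) (t x : F).

Lemma slice_open x : open [set t | W (t, x)].
Proof.
rewrite openE => t Wtx; exact: (open_near_t oW Wtx).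
Qed.

Lemma base_open : open (base P).
Proof.
rewrite openE => t [x Wtx]; have := open_near_t oW Wtx.
by apply: filterS => s Wsx; exists x.
Qed.

Lemma smooth_slice f x : smooth2 W f -> smooth [set t | W (t, x)] (fun t => f (t, x)).
Proof.
move=> sf n; suff H t : W (t, x) ->
    (fun t => f (t, x))^`(n) t = iterated_partial (nseq n false) f (t, x) /\
    derivable ((fun t => f (t, x))^`(n)) t 1.
  by move=> t /H[].
suff H s : W (s, x) -> (fun t => f (t, x))^`(n) s = iterated_partial (nseq n false) f (s, x).
  move=> Wtx; split; first exact: H.
  have [d _] := differentiable_is_derive_t (sf (nseq n false) _ Wtx).
  apply: near_eq_derivable d; apply: filterS (open_near_t oW Wtx) => s Wsx.
  by rewrite H.
elim: n s => // n IH s Wsx.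
rewrite derive1nS -[RHS]/(partial_t (iterated_partial (nseq n false) f) (s, x)).
by apply: near_eq_derive1; apply: filterS (open_near_t oW Wsx) => v; exact: IH.
Qed.

Lemma smooth_base_slices g : (forall x, smooth [set t | W (t, x)] g) -> smooth (base P) g.
Proof. by move=> H n t [x Wtx]; exact: (H x n t Wtx). Qed.

Lemma partial_t_base f g t x : (forall s x, W (s, x) -> f (s, x) = g s) ->
  W (t, x) -> partial_t f (t, x) = g^`() t.
Proof.
move=> fg Wtx; apply: near_eq_derive1; apply: filterS (open_near_t oW Wtx) => s.
exact: fg.
Qed.

Lemma partial_x_base f g t x : (forall s x, W (s, x) -> f (s, x) = g s) ->
  W (t, x) -> partial_x f (t, x) = 0.
Proof.
move=> fg Wtx; rewrite -(derive1_cst (g t) x); apply: near_eq_derive1.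
by apply: filterS (open_near_x oW Wtx) => s; exact: fg.
Qed.

Lemma smooth_of_slices f g : smooth2 W f -> (forall t x, W (t, x) -> f (t, x) = g t) ->
  smooth (base P) g.
Proof.
move=> sf fg; apply: smooth_base_slices => x.
apply: (@smooth_eq F _ (@slice_open x) (fun t => f (t, x))) => [t|]; first exact: fg.
exact: smooth_slice.
Qed.

Hypothesis mvi : mean_value_inequality F.
Hypothesis fiber_connected : forall t, connected [set x | W (t, x)].

Lemma fiber_open t : open [set x | W (t, x)].
Proof. rewrite openE => x Wtx; exact: (open_near_x oW Wtx). Qed.

Lemma const_on_fibers f : (forall t x, W (t, x) -> is_derive x 1 (fun s => f (t, s)) 0) ->
  exists g, forall t x, W (t, x) -> f (t, x) = g t.
Proof.
(* The value is read off at a chosen point of the fibre; the default 0 is taken only over empty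
   fibres. *)
move=> fd; exists (fun t => f (t, xget 0 [set x | W (t, x)])) => t x Wtx.
have Wg : W (t, xget 0 [set x | W (t, x)]).
  by apply: (@xgetPex _ 0 [set x | W (t, x)]); exists x.
exact: (@derive0_connected F mvi _ (fun s => f (t, s)) (@fiber_open t)
  (@fiber_connected t) (fd t) x _ Wtx Wg).
Qed.

Lemma smooth2_const_on_fibers f : smooth2 W f ->
  (forall t x, W (t, x) -> partial_x f (t, x) = 0) ->
  exists2 g, smooth (base P) g & forall t x, W (t, x) -> f (t, x) = g t.
Proof.
move=> sf fx; have [|g fg] := @const_on_fibers f.
  move=> t x Wtx; rewrite -(fx t x Wtx); apply: differentiable_is_derive_x.
  exact: smooth2_differentiable Wtx.
by exists g => //; exact: smooth_of_slices sf fg.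
Qed.

(** First the x-derivative is constant on fibres, equal to g; then f - x g has x-derivative 0 and is
    itself constant on fibres. *)
Lemma smooth2_affine_on_fibers f : smooth2 W f ->
  (forall t x, W (t, x) -> partial_x (partial_x f) (t, x) = 0) ->
  exists g h, [/\ smooth (base P) g, smooth (base P) h,
    forall t x, W (t, x) -> f (t, x) = x * g t + h t &
    forall t x, W (t, x) -> partial_x f (t, x) = g t].
Proof.
move=> sf fxx; have [g sg fg] := smooth2_const_on_fibers (smooth2_partial_x sf) fxx.
have [|h fh] := @const_on_fibers (fun p => f p - p.2 * g p.1).
  move=> t x Wtx /=.
  have fd := differentiable_is_derive_x (smooth2_differentiable sf Wtx).
  have := is_derive1D fd (is_derive1_affine 0 (- g t) x).
  rewrite fg // subrr; congr is_derive; apply/funext => s.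
  by rewrite add0r mulrN.
exists g, h; split=> // [|t x Wtx]; last by rewrite -(fh t x Wtx) /= addrC subrK.
apply: smooth_base_slices => x.
apply: (@smooth_eq F _ (@slice_open x) (fun t => f (t, x) + - x * g t)) => [t Wtx|].
  by rewrite -(fh t x Wtx) /= mulNr.
apply: (smoothD (@slice_open x)); first exact: smooth_slice.
apply: (smoothM (@slice_open x)); first exact: (smooth_cst (@slice_open x)).
by apply: smooth_sub sg => t Wtx; exists x.
Qed.

End BaseFunctions.

(** * Prolongations when T depends on t alone, and affinity of X in x *)

Section DependentVariable.
Variables (F : numFieldType) (P : transf F) (tau : F -> F).
Local Notation W := (tdom P).
Local Notation over_dom := (fun t y => W (t, y 0%N)).
Implicit Types (t x : F) (y : nat -> F) (g : jet_fun F).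

Hypothesis ptP : point_transformation P.
Hypothesis PT : forall t x, W (t, x) -> tT P (t, x) = tau t.

Let oW : open W. Proof. by have [[]] := ptP. Qed.
Let sT : smooth2 W (tT P). Proof. by case: ptP. Qed.
Let sX : smooth2 W (tX P). Proof. by case: ptP. Qed.
Let sub (t : F) (y : nat -> F) : over_dom t y -> W (t, y 0%N). Proof. by []. Qed.
Let oO : jet_open over_dom. Proof. exact: jet_open_base. Qed.

Lemma jacobian_fiber_preserving t x : W (t, x) ->
  tau^`() t != 0 /\ partial_x (tX P) (t, x) != 0.
Proof.
move=> Wtx; have [_ _ _ /(_ _ Wtx)] := ptP.
rewrite /jacobian_det (partial_x_base oW PT) // mul0r subr0 (partial_t_base oW PT Wtx).
by rewrite mulf_eq0 negb_or => /andP.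
Qed.

Definition inv_rate : jet_fun F := fun t _ => (tau^`()%classic t)^-1.
Local Notation u := inv_rate.
Local Notation jr := (jet_rational W over_dom).

Lemma DT_fiber_preserving t y : W (t, y 0%N) -> DT P t y = tau^`() t.
Proof.
by move=> Wty; rewrite DTE // (partial_x_base oW PT) // mulr0 addr0 (partial_t_base oW PT Wty).
Qed.

Lemma prolongS k t y : W (t, y 0%N) ->
  prolong P k.+1 t y = u t y * total_deriv k (prolong P k) t y.
Proof. by move=> Wty; rewrite [LHS]/(_ / _) DT_fiber_preserving // mulrC. Qed.

Lemma jet_inv_rate n : jr n u.
Proof.
have jt := jet_base over_dom n (smooth2_partial_t sT).
apply: jet_eq (jet_inv jt _) _ => t y Wty; rewrite (partial_t_base oW PT Wty) //.
exact: (jacobian_fiber_preserving Wty).1.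
Qed.

(** For k > 0 this is the coefficient X_x / T_t^k of x^(k) in the k-th prolongation when k > 2 or k
    = 1, and of x^(2) when k = 2; [lead_x] is its x-derivative. *)
Definition lead k : jet_fun F := fun t y => u t y ^+ k * partial_x (tX P) (t, y 0%N).
Definition lead_x k : jet_fun F := fun t y =>
  u t y ^+ k * partial_x (partial_x (tX P)) (t, y 0%N).

Lemma jet_lead k n : jr n (lead k).
Proof.
by apply: jet_mul; [exact: jet_exp (jet_inv_rate n)|
  exact: (jet_base _ _ (smooth2_partial_x sX))].
Qed.

Lemma jet_lead_x k n : jr n (lead_x k).
Proof.
by apply: jet_mul; [exact: jet_exp (jet_inv_rate n)|
  exact: (jet_base _ _ (smooth2_partial_x (smooth2_partial_x sX)))].
Qed.

Lemma total_deriv_order0 n g t y : jr 0 g -> W (t, y 0%N) ->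
  total_deriv n g t y = jderiv None g t y + y 1%N * jderiv (Some 0%N) g t y.
Proof.
move=> g0 Wty; rewrite (total_deriv_stable oO g0) // total_derivE.
by rewrite big_ord1.
Qed.

Lemma total_deriv_lead n k t y : W (t, y 0%N) ->
  total_deriv n (lead k) t y = jderiv None (lead k) t y + y 1%N * lead_x k t y.
Proof.
move=> Wty; rewrite (total_deriv_order0 n (jet_lead k 0)) //; congr (_ + _ * _).
have jx := jet_base over_dom 0 (smooth2_partial_x sX).
rewrite (jderivM sub oO (Some 0%N) (jet_exp k (jet_inv_rate 0)) jx) //.
have [_ -> _] := jderiv_base (partial_x (tX P)) Wty.
by rewrite [X in X * _](derive1_cst (u t y ^+ k)) mul0r add0r.
Qed.

Lemma jet_total_deriv_le a n g : jr a g -> (a <= n)%N -> jr a.+1 (total_deriv n g).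
Proof.
move=> ag an; apply: jet_eq (jet_total_deriv sub oO ag) _ => t y Wty.
by rewrite (total_deriv_stable oO ag).
Qed.

Lemma leadS k t y : u t y * lead k t y = lead k.+1 t y.
Proof. by rewrite /lead exprS mulrA. Qed.

Lemma lead_xS k t y : u t y * lead_x k t y = lead_x k.+1 t y.
Proof. by rewrite /lead_x exprS mulrA. Qed.

Definition drift : jet_fun F := fun t y => u t y * partial_t (tX P) (t, y 0%N).

Lemma jet_drift n : jr n drift.
Proof.
apply: jet_mul; first exact: jet_inv_rate.
exact: (jet_base _ _ (smooth2_partial_t sX)).
Qed.

Lemma prolong1E t y : W (t, y 0%N) ->
  prolong P 1 t y = lead 1 t y * y 1%N + drift t y.
Proof.
move=> Wty; rewrite prolongS // (total_deriv_base sub 0 (tX P)) // /lead /drift expr1.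
by rewrite mulrDr addrC; congr (_ + _); rewrite [y 1%N * _]mulrC mulrA.
Qed.

(** Only the differentiation of the top coordinate raises the order; it multiplies the leading
    coefficient by 1/T_t, and all other terms go into the remainder. *)
Lemma prolong_lead k : exists2 M, jr k M & forall t y, W (t, y 0%N) ->
  prolong P k.+1 t y = lead k.+1 t y * y k.+1 + M t y.
Proof.
elim: k => [|k [M jM HM]]; first by exists drift; [exact: jet_drift|exact: prolong1E].
exists (fun t y => u t y * (total_deriv k.+1 (lead k.+1) t y * y k.+1
                            + total_deriv k.+1 M t y)).
  apply: jet_mul; first exact: jet_inv_rate.
  apply: jet_add; last exact: (jet_total_deriv_le jM).
  apply: jet_mul; last exact: jet_coord.
  by apply: (jet_weaken (n := 1)) => //; apply: (jet_total_deriv_le (jet_lead _ 0)).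
move=> t y Wty; rewrite prolongS //.
rewrite (total_deriv_eq oO _ (h := fun t y => lead k.+1 t y * y k.+1 + M t y)) //.
have jc : jr k.+1 (fun _ y => y k.+1) by exact: jet_coord.
have jl := jet_lead k.+1 0.
rewrite (total_derivD sub oO _ (jet_mul (jet_lead _ _) jc) jM) //.
rewrite (total_derivM sub oO _ jl jc) // total_deriv_coord // -(leadS k.+1).
set a := total_deriv _ _ _ _; set b := total_deriv _ _ _ _.
by ring.
Qed.

Lemma prolong2E : exists w z, [/\ jr 0 w, jr 0 z & forall t y, W (t, y 0%N) ->
  prolong P 2 t y = lead 2 t y * y 2%N + lead_x 2 t y * y 1%N ^+ 2
    + w t y * y 1%N + z t y].
Proof.
pose w : jet_fun F := fun t y => u t y * (jderiv None (lead 1) t y + jderiv (Some 0%N) drift t y).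
pose z : jet_fun F := fun t y => u t y * jderiv None drift t y.
exists w, z; split.
- apply: jet_mul; first exact: jet_inv_rate.
  by apply: jet_add; apply: (jet_jderiv sub oO); [exact: jet_lead|exact: jet_drift].
- apply: jet_mul; first exact: jet_inv_rate.
  by apply: (jet_jderiv sub oO); exact: jet_drift.
move=> t y Wty; rewrite prolongS //.
rewrite (total_deriv_eq oO _ (h := fun t y => lead 1 t y * y 1%N + drift t y)) //;
  last exact: prolong1E.
have jc : jr 1 (fun _ y => y 1%N) by exact: jet_coord.
rewrite (total_derivD sub oO _ (jet_mul (jet_lead 1 _) jc) (jet_drift 0)) //.
rewrite (total_derivM sub oO _ (jet_lead 1 0) jc) // total_deriv_coord //.
rewrite total_deriv_lead // (total_deriv_order0 _ (jet_drift 0)) //.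
rewrite -(leadS 1) -(lead_xS 1) /w /z.
move: (lead 1 t y) (lead_x 1 t y) (jderiv None (lead 1) t y) (jderiv None drift t y).
by move: (jderiv (Some 0%N) drift t y) (u t y) => *; ring.
Qed.

(* Differentiating [x^(1)^2] once more is what makes the coefficient of
   [x^(1) x^(k.+2)] equal to [k.+3]. *)
Lemma prolong_sublead k : exists w L, [/\ jr 0 w, jr k.+1 L & forall t y, W (t, y 0%N) ->
  prolong P k.+3 t y = lead k.+3 t y * y k.+3
    + (k.+3%:R * lead_x k.+3 t y * y 1%N + w t y) * y k.+2 + L t y].
Proof.
elim: k => [|k [w [L [jw jL HL]]]].
  have [w [z [jw jz H2]]] := prolong2E.
  have jl := jet_lead 2 0; have jlx := jet_lead_x 2 0.
  have j1 : jr 1 (fun _ y => y 1%N) by exact: jet_coord.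
  have j2 : jr 2 (fun _ y => y 2%N) by exact: jet_coord.
  pose L : jet_fun F := fun t y => u t y * (total_deriv 2 (lead_x 2) t y * y 1%N ^+ 2
    + total_deriv 2 w t y * y 1%N + total_deriv 2 z t y).
  exists (fun t y => u t y * (jderiv None (lead 2) t y + w t y)), L; split.
  - apply: jet_mul; first exact: jet_inv_rate.
    by apply: jet_add => //; exact: (jet_jderiv sub oO).
  - apply: jet_mul; first exact: jet_inv_rate.
    apply: jet_add; last exact: (jet_total_deriv_le jz).
    apply: jet_add.
      by apply: jet_mul; [exact: (jet_total_deriv_le jlx)|exact: jet_exp].
    by apply: jet_mul => //; exact: (jet_total_deriv_le jw).
  move=> t y Wty; rewrite prolongS //.
  rewrite (total_deriv_eq oO _ (h := fun t y => lead 2 t y * y 2%N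
    + lead_x 2 t y * y 1%N ^+ 2 + w t y * y 1%N + z t y)) //.
  have jx1 := jet_exp 2 j1.
  have jA : jr 2 (fun t y => lead 2 t y * y 2%N) := jet_mul (jet_lead _ _) j2.
  have jB : jr 2 (fun t y => lead_x 2 t y * y 1%N ^+ 2).
    by apply: jet_mul; [exact: jet_lead_x|exact: jet_weaken jx1].
  have jC : jr 2 (fun t y => w t y * y 1%N).
    by apply: jet_mul; [exact: jet_weaken jw|exact: jet_weaken j1].
  rewrite (total_derivD sub oO _ (jet_add (jet_add jA jB) jC) jz) //.
  rewrite (total_derivD sub oO _ (jet_add jA jB) jC) //.
  rewrite (total_derivD sub oO _ jA jB) //.
  rewrite (total_derivM sub oO _ jl j2) // (total_derivM sub oO _ jlx jx1) //.
  rewrite (total_derivM sub oO _ jw j1) // (total_derivX _ _ sub oO j1) //.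
  rewrite !total_deriv_coord // total_deriv_lead // -(leadS 2) -(lead_xS 2) /L.
  move: (total_deriv 2 (lead_x 2) t y) (total_deriv 2 w t y) (total_deriv 2 z t y).
  move: (lead 2 t y) (lead_x 2 t y) (jderiv None (lead 2) t y) (u t y) (w t y).
  by move=> *; ring.
have jl := jet_lead k.+3 0; have jlx := jet_lead_x k.+3 0.
have j1 : jr 1 (fun _ y => y 1%N) by exact: jet_coord.
have jk2 : jr k.+2 (fun _ y => y k.+2) by exact: jet_coord.
have jk3 : jr k.+3 (fun _ y => y k.+3) by exact: jet_coord.
pose L' : jet_fun F := fun t y => u t y *
  ((k.+3%:R * (total_deriv k.+3 (lead_x k.+3) t y * y 1%N + lead_x k.+3 t y * y 2%N)
    + total_deriv k.+3 w t y) * y k.+2 + total_deriv k.+3 L t y).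
exists (fun t y => u t y * (jderiv None (lead k.+3) t y + w t y)), L'; split.
- apply: jet_mul; first exact: jet_inv_rate.
  by apply: jet_add => //; exact: (jet_jderiv sub oO).
- apply: jet_mul; first exact: jet_inv_rate.
  apply: jet_add; last by apply: (jet_total_deriv_le jL); exact: leqW (leqnSn _).
  apply: jet_mul => //; apply: jet_add; last first.
    by apply: (jet_weaken (n := 1)) => //; exact: (jet_total_deriv_le jw).
  apply: jet_mul; first exact: jet_cst.
  apply: jet_add.
    apply: jet_mul; last by exact: jet_weaken j1.
    by apply: (jet_weaken (n := 1)) => //; exact: (jet_total_deriv_le jlx).
  by apply: jet_mul; [exact: jet_lead_x|exact: jet_coord].
move=> t y Wty; rewrite prolongS //.
rewrite (total_deriv_eq oO _ (h := fun t y => lead k.+3 t y * y k.+3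
    + (k.+3%:R * lead_x k.+3 t y * y 1%N + w t y) * y k.+2 + L t y)) //.
have jA : jr k.+3 (fun t y => lead k.+3 t y * y k.+3) := jet_mul (jet_lead _ _) jk3.
have jc : jr 0 (fun _ _ => k.+3%:R) by exact: jet_cst.
have jcx : jr 0 (fun t y => k.+3%:R * lead_x k.+3 t y) := jet_mul jc jlx.
have jcx1 : jr 1 (fun t y => k.+3%:R * lead_x k.+3 t y * y 1%N).
  by apply: jet_mul => //; exact: jet_weaken jcx.
have jB : jr 1 (fun t y => k.+3%:R * lead_x k.+3 t y * y 1%N + w t y).
  by apply: jet_add => //; exact: jet_weaken jw.
have jBk : jr k.+3 (fun t y => (k.+3%:R * lead_x k.+3 t y * y 1%N + w t y) * y k.+2).
  by apply: jet_mul; [exact: jet_weaken jB|exact: jet_weaken jk2].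
rewrite (total_derivD sub oO _ (jet_add jA jBk) jL) //.
rewrite (total_derivD sub oO _ jA jBk) // (total_derivM sub oO _ jl jk3) //.
rewrite (total_derivM sub oO _ jB jk2) // (total_derivD sub oO _ jcx1 jw) //.
rewrite (total_derivM sub oO _ jcx j1) // (total_derivM sub oO _ jc jlx) //.
rewrite total_deriv_cst !total_deriv_coord // total_deriv_lead //.
(* The coefficient k + 3 is inherited from x^(1) x^(k+2), and the additional 1 comes from
   differentiating [lead] with respect to x. *)
rewrite -(leadS k.+3) -(lead_xS k.+3) /L' -[k.+4%:R]natr1.
move: (total_deriv k.+3 (lead_x k.+3) t y) (total_deriv k.+3 w t y) (total_deriv k.+3 L t y).
move: (lead k.+3 t y) (lead_x k.+3 t y) (jderiv None (lead k.+3) t y) (u t y) (w t y).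
move: (k.+3%:R : F) => *; ring.
Qed.

Lemma jet_prolong k : jr k (prolong P k).
Proof.
elim: k => [|k IH]; first exact: (jet_base _ _ sX).
apply: jet_eq (jet_mul (jet_inv_rate _) (jet_total_deriv sub oO IH)) _ => t y Wty.
by rewrite prolongS.
Qed.

Variables (r : nat) (E Et : ode F).
Hypothesis r3 : (3 <= r)%N.
Hypothesis PE : maps_ode r E Et P.

(* Comparing the coefficients of [x^(r-1)] and then of [x^(1) x^(r-1)]. *)
Lemma maps_ode_Xxx0 t x : W (t, x) -> partial_x (partial_x (tX P)) (t, x) = 0.
Proof.
move=> Wtx; case: r r3 PE => [|[|[|k]]] // _ [_ PE3].
have [w [L [jw jL HL]]] := prolong_sublead k.
have [M jM HM] := prolong_lead k.+1.
(* Here r = k + 3; the free parameters are a = x^(1) and b = x^(r-1), distinct coordinates because r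
   >= 3. *)
pose q (a b : F) (j : nat) : F :=
  if j == 0%N then x else if j == 1%N then a else if j == k.+2 then b else 0.
pose c (a b : F) (j : nat) : F :=
  if j == k.+3 then rhs E t - \sum_(1 <= i < k.+3) coef E i t * q a b i else q a b j.
have cq a b j : (j < k.+3)%N -> c a b j = q a b j by rewrite /c => jk; rewrite ltn_eqF.
have Wc a b : W (t, c a b 0%N) by [].
have ck a b : c a b k.+2 = b by rewrite cq // /q eqxx.
have c1 a b : c a b 1%N = a by [].
have sat a b : satisfies k.+3 E t (c a b).
  rewrite /satisfies {1}/c eqxx -[RHS](subrK (\sum_(1 <= i < k.+3) coef E i t * q a b i)).
  by congr (_ + _); apply: eq_big_nat => i /andP[_ ik]; rewrite cq.
have top a : c a 1 k.+3 = c a 0 k.+3 - coef E k.+2 t.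
  have qk b : q a b k.+2 = b by rewrite /q eqxx.
  have cE b : c a b k.+3 =
      rhs E t - (\sum_(1 <= i < k.+2) coef E i t * q a 0 i + coef E k.+2 t * b).
    rewrite /c eqxx (@big_nat_recr _ _ _ k.+2) //= qk; congr (_ - (_ + _)).
    by apply: eq_big_nat => i /andP[i1 ik]; rewrite /q (ltn_eqF ik).
  by rewrite !cE mulr1 mulr0 addr0 opprD addrA.
have low a (g : jet_fun F) : jr k.+1 g -> g t (c a 1) = g t (c a 0).
  move=> jg; apply: (jet_dep jg) => // j jk.
  have jk2 : (j < k.+2)%N by [].
  have jk3 : (j < k.+3)%N by exact: ltnW.
  by rewrite (cq a 1 j jk3) (cq a 0 j jk3) /q (ltn_eqF jk2).
have order0 a b (g : jet_fun F) : jr 0 g -> g t (c a b) = g t (c 0 0).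
  by move=> jg; apply: (jet_dep jg) => // j; rewrite leqn0 => /eqP ->.
have u0 : u t (c 0 0) != 0.
  by rewrite invr_eq0; exact: (jacobian_fiber_preserving Wtx).1.
have DTc a b : DT P t (c a b) != 0.
  by rewrite DT_fiber_preserving //; exact: (jacobian_fiber_preserving Wtx).1.
have Psat a b : satisfies k.+3 Et (tT P (t, x)) (fun j => prolong P j t (c a b)).
  exact: (PE3 _ _ (Wc a b) (DTc a b)).1 (sat a b).
pose e := c 0 0.
have recr (f : nat -> F) :
    \sum_(1 <= i < k.+3) f i = \sum_(1 <= i < k.+2) f i + f k.+2.
  by rewrite big_nat_recr.
(* The target equation at b = 1 minus that at b = 0: terms of order below r - 1 cancel, and x^(r)
   changes by minus the coefficient of x^(r-1) in [E]. *)
have key a : lead k.+3 t e * - coef E k.+2 t + (k.+3%:R * lead_x k.+3 t e * a + w t e)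
    + coef Et k.+2 (tT P (t, x)) * lead k.+2 t e = 0.
  have := Psat a 1; rewrite /satisfies -(Psat a 0) !recr.
  have -> : \sum_(1 <= i < k.+2) coef Et i (tT P (t, x)) * prolong P i t (c a 1) =
            \sum_(1 <= i < k.+2) coef Et i (tT P (t, x)) * prolong P i t (c a 0).
    apply: eq_big_nat => i /andP[_ ik]; congr (_ * _); apply: low.
    exact: jet_weaken (jet_prolong i).
  rewrite !HL // !HM // !(low a L) // !(low a M) // top !ck !c1.
  rewrite !(order0 _ _ _ (jet_lead _ _)) !(order0 _ _ _ (jet_lead_x _ _)) !(order0 _ _ w) // -/e.
  move/eqP; rewrite -subr_eq0 => /eqP <-.
  move: (lead k.+3 t e) (lead_x k.+3 t e) (lead k.+2 t e) (c a 0 k.+3) (L t _) (M t _) (w t e).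
  move: (\sum_(1 <= i < k.+2) _) (k.+3%:R : F) (coef E _ _) (coef Et _ _) => *; ring.
(* The identity [key] is affine in a; its values at a = 1 and a = 0 isolate the slope. *)
have : k.+3%:R * lead_x k.+3 t e = 0.
  have := key 1; rewrite -[RHS](key 0) mulr0 add0r mulr1 => /addIr/addrI.
  by rewrite -[RHS]add0r => /addIr.
move/eqP; rewrite mulf_eq0 pnatr_eq0 /= /lead_x mulf_eq0 expf_eq0 (negPf u0) andbF /=.
by move/eqP.
Qed.

End DependentVariable.

(** * Fibre-affine transformations *)

Lemma near_eq_differentiable (K : numFieldType) (V U : normedModType K)
    (f g : V -> U) (p : V) : (\forall q \near p, f q = g q) ->
  differentiable f p -> differentiable g p.
Proof.
move=> fg df; have fgp : f p = g p := nbhs_singleton fg.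
have H : g \o shift p = cst (g p) + 'd f p +o_ 0 id.
  apply/eqaddoP => e e0; have /eqaddoP/(_ e e0) := diff_locally df.
  have near0 : \forall q \near (0 : V), f (q + p) = g (q + p).
    by move: fg; rewrite (near_shift 0) subr0.
  apply: filter_app; apply: filterS near0 => q /= fgq.
  by rewrite !fctE /= /cst fgq fgp.
have E := diff_unique (diff_continuous df) H.
by apply/diff_locallyP; rewrite E; split => //; exact: diff_continuous.
Qed.

Lemma fst_differentiable (K : numFieldType) (V U : normedModType K) (p : V * U) :
  differentiable fst p.
Proof.
apply: (@linear_differentiable _ _ _ (fst : {linear (V * U)%type -> V})).
by move=> x; exact: cvg_fst.
Qed.

Lemma snd_differentiable (K : numFieldType) (V U : normedModType K) (p : V * U) :
  differentiable snd p.
Proof.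
apply: (@linear_differentiable _ _ _ (snd : {linear (V * U)%type -> U})).
by move=> x; exact: cvg_snd.
Qed.

Section FiberAffineFunctions.
Variables (F : numFieldType) (P : transf F).
Local Notation W := (tdom P).
Hypothesis oW : open W.
Implicit Types (f : F * F -> F) (g h : F -> F).

(** This class is closed under both partial derivatives, so differentiability of its members already
    gives [smooth2]. *)
Definition fiber_affine f := exists g h, [/\ smooth (base P) g, smooth (base P) h &
  forall t x, W (t, x) -> f (t, x) = g t + x * h t].

Lemma fiber_affine_differentiable f p : fiber_affine f -> W p -> differentiable f p.
Proof.
move=> [g [h [sg sh fE]]] Wp.
apply: (@near_eq_differentiable _ _ _ (fun q : F * F => g q.1 + q.2 * h q.1)).
  have : \forall q \near p, W q by exact: open_nbhs_nbhs.
  by apply: filterS => -[t x] /fE ->.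
have Bp : base P p.1 by exists p.2; case: p Wp.
have dcomp k : smooth (base P) k -> differentiable (fun q : F * F => k q.1) p.
  move=> sk; have dk : differentiable k p.1 by apply/derivable1_diffP; exact: (sk 0%N).
  exact: (differentiable_comp (fst_differentiable p) dk).
apply: differentiableD; first exact: dcomp.
by apply: differentiableM; [exact: snd_differentiable|exact: dcomp].
Qed.

Lemma fiber_affine_partial_t f : fiber_affine f -> fiber_affine (partial_t f).
Proof.
move=> [g [h [sg sh fE]]]; exists g^`(), h^`(); split; [exact: smooth_derive1..|].
move=> t x Wtx; have Bt : base P t by exists x.
have near_t : \forall s \near t, g s + x * h s = f (s, x).
  by apply: filterS (open_near_t oW Wtx) => s /fE ->.
apply: is_derive_derive1; apply: (near_eq_is_derive near_t).
apply: (is_derive1D (smooth_is_derive sg Bt)).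
have := is_derive1M (is_derive_cst x t 1) (smooth_is_derive sh Bt).
by rewrite mul0r add0r.
Qed.

Lemma fiber_affine_partial_xE f g h t x :
  (forall t x, W (t, x) -> f (t, x) = g t + x * h t) -> W (t, x) ->
  partial_x f (t, x) = h t.
Proof.
move=> fE Wtx.
have near_x : \forall s \near x, g t + s * h t = f (t, s).
  by apply: filterS (open_near_x oW Wtx) => s /fE ->.
by apply: is_derive_derive1; apply: (near_eq_is_derive near_x); exact: is_derive1_affine.
Qed.

Lemma fiber_affine_smooth2 f : fiber_affine f -> smooth2 W f.
Proof.
move=> af w p Wp; apply: fiber_affine_differentiable (Wp).
elim: w => //= b w IH; case: b; last exact: fiber_affine_partial_t.
case: IH => g [h [sg sh fE]]; exists h, (fun=> 0).
split; [exact: sh|exact: smooth_cst (base_open oW) _|].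
by move=> t x Wtx; rewrite mulr0 addr0; exact: fiber_affine_partial_xE fE Wtx.
Qed.

End FiberAffineFunctions.

(** Differentiating a sum of c_i z_i with z_i' = z_(i+1) gives the new coefficients c_i' + c_(i-1);
    this is the reindexing behind that recursion. *)
Lemma shift_sum (K : pzRingType) (a b z : nat -> K) k : a k.+1 = 0 ->
  \sum_(i < k.+2) (a i + (if (i : nat) is i'.+1 then b i' else 0)) * z i =
  \sum_(i < k.+1) (a i * z i + b i * z i.+1).
Proof.
move=> a0; rewrite big_split /=.
under eq_bigr do rewrite mulrDl; rewrite big_split /=; congr (_ + _).
  by rewrite big_ord_recr /= a0 mul0r addr0.
by rewrite big_ord_recl /= mul0r add0r.
Qed.

(** * Transformations of the stated form and their inverse on jets *)

Section AffineTransformation.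
Variables (F : numFieldType) (P : transf F) (T X0 psi : F -> F).
Local Notation W := (tdom P).
Local Notation B := (base P).
Implicit Types (t x : F) (y : nat -> F).

Hypothesis oW : open W.
Hypothesis sT : smooth B T.
Hypothesis sX0 : smooth B X0.
Hypothesis spsi : smooth B psi.
Hypothesis T'0 : forall t, B t -> T^`() t != 0.
Hypothesis psi0 : forall t, B t -> psi t != 0.
Hypothesis PE : forall t x, W (t, x) -> tT P (t, x) = T t /\ tX P (t, x) = x / psi t + X0 t.

Let oB : open B. Proof. exact: base_open. Qed.
Let base_of t x : W (t, x) -> B t. Proof. by exists x. Qed.

(* On the fibres over the base, [prolong P k] is the affine function
   [\sum_i pcoef k i * x^(i) + pconst k], and conversely
   [x^(k) = \sum_j qcoef k j * (prolong P j - pconst j)]. *)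
Fixpoint pcoef k i : F -> F :=
  if k is k'.+1 then fun t => ((pcoef k' i)^`()%classic t
    + (if i is i'.+1 then pcoef k' i' t else 0)) / T^`()%classic t
  else fun t => if i is 0 then (psi t)^-1 else 0.

Fixpoint pconst k : F -> F :=
  if k is k'.+1 then fun t => (pconst k')^`()%classic t / T^`()%classic t else X0.

Fixpoint qcoef k j : F -> F :=
  if k is k'.+1 then fun t => (qcoef k' j)^`()%classic t
    + (if j is j'.+1 then T^`()%classic t * qcoef k' j' t else 0)
  else fun t => if j is 0 then psi t else 0.

Let sT'V : smooth B (fun t => (T^`()%classic t)^-1).
Proof. exact: smoothV oB _ T'0 (smooth_derive1 sT). Qed.

Lemma smooth_pcoef k i : smooth B (pcoef k i).
Proof.
elim: k i => [|k IH] [|i] /=.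
- exact: smoothV oB _ psi0 spsi.
- exact: smooth_cst oB _.
- apply: (smoothM oB _ sT'V); apply: (smoothD oB); first exact: smooth_derive1 (IH _).
  exact: smooth_cst oB _.
- apply: (smoothM oB _ sT'V); apply: (smoothD oB); last exact: IH i.
  exact: smooth_derive1 (IH _).
Qed.

Lemma smooth_pconst k : smooth B (pconst k).
Proof.
elim: k => [|k IH] /=; first exact: sX0.
exact: (smoothM oB (smooth_derive1 IH) sT'V).
Qed.

Lemma smooth_qcoef k j : smooth B (qcoef k j).
Proof.
elim: k j => [|k IH] [|j] /=.
- exact: spsi.
- exact: smooth_cst oB _.
- by apply: (smoothD oB); [exact: smooth_derive1 (IH 0%N)|exact: smooth_cst oB _].
- apply: (smoothD oB); first exact: smooth_derive1 (IH j.+1).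
  exact: (smoothM oB (smooth_derive1 sT) (IH j)).
Qed.

Lemma derive1_eq0_on (f : F -> F) t : (forall s, B s -> f s = 0) -> B t -> f^`() t = 0.
Proof. by move=> f0 Bt; rewrite (derive1_eq_on oB f0 Bt) derive1_cst. Qed.

Lemma pcoef_high k i t : (k < i)%N -> B t -> pcoef k i t = 0.
Proof.
elim: k i t => [|k IH] [|i] t //= ki Bt.
rewrite IH // addr0 (@derive1_eq0_on (pcoef k i.+1)) ?mul0r // => s Bs.
by apply: IH => //; exact: ltnW.
Qed.

Lemma qcoef_high k j t : (k < j)%N -> B t -> qcoef k j t = 0.
Proof.
elim: k j t => [|k IH] [|j] t //= kj Bt.
rewrite (IH j) // mulr0 addr0 (@derive1_eq0_on (qcoef k j.+1)) // => s Bs.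
by apply: IH => //; exact: ltnW.
Qed.

Lemma qcoef_diag k t : B t -> qcoef k k t = psi t * T^`()%classic t ^+ k.
Proof.
elim: k t => [|k IH] t Bt /=; first by rewrite mulr1.
rewrite (@derive1_eq0_on (qcoef k k.+1)) // => [|s Bs]; last exact: qcoef_high.
by rewrite add0r IH // exprS mulrCA.
Qed.

(** This is how the new unknown function itself enters x^(k); it links its coefficient in the
    transformed equation to the source operator at psi. *)
Lemma qcoef0 k t : qcoef k 0 t = psi^`(k) t.
Proof.
rewrite (_ : qcoef k 0 = psi^`(k)) //; elim: k => //= k IH.
by apply/funext => s; rewrite IH addr0.
Qed.

Lemma pcoefS k i t : B t -> T^`()%classic t * pcoef k.+1 i t =
  (pcoef k i)^`()%classic t + (if i is i'.+1 then pcoef k i' t else 0).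
Proof. by move=> Bt; rewrite mulrC /= divfK //; exact: T'0. Qed.

(** The two triangular matrices are inverse to each other: the identity for k + 1 arises by
    differentiating the one for k, whose right-hand side is constant. *)
Lemma qcoef_pcoef k i t : B t ->
  \sum_(j < k.+1) qcoef k j t * pcoef j i t = (k == i)%:R.
Proof.
elim: k i t => [|k IH] i t Bt.
  rewrite big_ord1 /=; case: i => [|i] /=; last by rewrite mulr0.
  by rewrite mulfV //; exact: psi0.
rewrite -[LHS]/(\sum_(j < k.+2) ((qcoef k j)^`()%classic t
  + (if (j : nat) is j'.+1 then T^`()%classic t * qcoef k j' t else 0)) * pcoef j i t).
rewrite (shift_sum (a := fun j => (qcoef k j)^`()%classic t)
  (fun j => T^`()%classic t * qcoef k j t) (fun j => pcoef j i t)); last first.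
  by apply: derive1_eq0_on => // s Bs; exact: qcoef_high.
pose f s := \sum_(j < k.+1) qcoef k j s * pcoef j i s.
have f'0 : f^`() t = 0.
  by rewrite (derive1_eq_on oB (fun s Bs => IH i s Bs) Bt) derive1_cst.
have := is_derive_derive1 (is_derive1_sum (fun j : 'I_k.+1 =>
  is_derive1M (smooth_is_derive (@smooth_qcoef k j) Bt)
              (smooth_is_derive (@smooth_pcoef j i) Bt))).
rewrite -/f f'0 => f'E.
transitivity (\sum_(j < k.+1) (((qcoef k j)^`()%classic t * pcoef j i t
    + qcoef k j t * (pcoef j i)^`()%classic t)
    + qcoef k j t * (if i is i'.+1 then pcoef j i' t else 0))).
  apply: eq_bigr => j _; rewrite -addrA -mulrDr -pcoefS //; congr (_ + _).
  by rewrite [RHS]mulrCA [RHS]mulrA.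
rewrite big_split /= -f'E add0r; case: i {f f'0 f'E} => [|i].
  by rewrite big1 // => j _; rewrite mulr0.
by rewrite IH.
Qed.

Let oO : jet_open (fun t y => W (t, y 0%N)). Proof. exact: jet_open_base. Qed.

Lemma DT_affine t y : W (t, y 0%N) -> DT P t y = T^`() t.
Proof.
move=> Wty; have PT t' x' (H : W (t', x')) := (PE H).1.
by rewrite DTE // (partial_x_base oW PT) // mulr0 addr0 (partial_t_base oW PT).
Qed.

Lemma prolong_affine k t y : W (t, y 0%N) ->
  prolong P k t y = \sum_(i < k.+1) pcoef k i t * y i + pconst k t.
Proof.
elim: k t y => [|k IH] t y Wty.
  by rewrite big_ord1 /= (PE Wty).2 mulrC.
have Bt := base_of Wty.
pose V : jet_fun F := fun t y => \sum_(i < k.+1) pcoef k i t * y i + pconst k t.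
rewrite -[LHS]/(total_deriv k (prolong P k) t y / DT P t y) DT_affine //.
rewrite (total_deriv_eq oO k (h := V)) // total_derivE.
have -> : jderiv None V t y =
    \sum_(i < k.+1) (pcoef k i)^`()%classic t * y i + (pconst k)^`()%classic t.
  apply: is_derive_derive1; apply: is_derive1D; last first.
    exact: (smooth_is_derive (@smooth_pconst k)).
  apply: is_derive1_sum => i.
  have := is_derive1M (smooth_is_derive (@smooth_pcoef k i) Bt) (is_derive_cst (y i) t 1).
  by rewrite mulr0 addr0.
have jV (j : 'I_k.+1) : jderiv (Some (j : nat)) V t y = pcoef k j t.
  apply: is_derive_derive1; rewrite -[pcoef k j t]addr0.
  apply: is_derive1D; last exact: (is_derive_cst (pconst k t) (y j) 1).
  have -> : pcoef k j t = \sum_(i < k.+1) pcoef k i t * (i == j)%:R.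
    rewrite (bigD1 j) //= eqxx mulr1 big1 ?addr0 // => i /negPf ->.
    by rewrite mulr0.
  apply: is_derive1_sum => i /=; rewrite -[(i : nat) == j]/(i == j).
  case: eqP => [->|_].
    have := is_derive1M (is_derive_cst (pcoef k j t) (y j) 1) (is_derive_id (y j) 1).
    by rewrite mul0r add0r.
  by rewrite mulr0; exact: (is_derive_cst (pcoef k i t * y i) (y j) 1).
under [X in _ + X]eq_bigr do rewrite jV mulrC.
rewrite addrAC -big_split /=.
rewrite -(shift_sum (a := fun i => (pcoef k i)^`()%classic t) (fun i => pcoef k i t) y).
  by rewrite mulrDl mulr_suml; congr (_ + _); apply: eq_bigr => i _; rewrite mulrAC.
by apply: derive1_eq0_on => // s Bs; exact: pcoef_high.
Qed.

(** The linear part x / psi sends psi to the constant 1, whose transformed derivatives of positive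
    order vanish. *)
Lemma pcoef_derive1n_psi k t : B t ->
  \sum_(i < k.+1) pcoef k i t * psi^`(i)%classic t = (k == 0%N)%:R.
Proof.
elim: k t => [|k IH] t Bt.
  by rewrite big_ord1 /= mulVf //; exact: psi0.
rewrite -[LHS](mulKf (T'0 Bt)) mulr_sumr.
under eq_bigr do rewrite mulrA pcoefS //.
rewrite (shift_sum (a := fun i => (pcoef k i)^`()%classic t) (fun i => pcoef k i t)
  (fun i => psi^`(i)%classic t)); last by apply: derive1_eq0_on => // s Bs; exact: pcoef_high.
have := is_derive_derive1 (is_derive1_sum (fun i : 'I_k.+1 =>
  is_derive1M (smooth_is_derive (@smooth_pcoef k i) Bt)
    (smooth_is_derive (smooth_derive1n (n := i) spsi) Bt))).
rewrite (derive1_eq_on oB (fun s Bs => IH s Bs) Bt) derive1_cst.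
by under [X in _ = X -> _]eq_bigr do rewrite -derive1nS; move=> <-; rewrite mulr0.
Qed.

Lemma prolong_psi k t y e : (0 < k)%N -> W (t, y 0%N) ->
  W (t, y 0%N + e * psi t) ->
  prolong P k t (fun i => y i + e * psi^`(i)%classic t) = prolong P k t y.
Proof.
move=> k0 Wty Wty'; have Bt := base_of Wty.
rewrite !prolong_affine //; congr (_ + _).
under eq_bigr do rewrite mulrDr mulrCA.
rewrite big_split /= -mulr_sumr pcoef_derive1n_psi //.
by rewrite (gtn_eqF k0) mulr0 addr0.
Qed.

(* The jets of [x] and of [x + e psi] have the same prolongations of positive
   order, and these are all that [Et] involves. *)
Lemma maps_ode_psi r (E Et : ode F) : (0 < r)%N -> maps_ode r E Et P ->
  solution_on r (homogeneous E) B psi.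
Proof.
move=> r0 [PD PS]; split=> // [t [x Wtx]|t [x Wtx]]; first by have [] := PD _ Wtx.
have Bt := base_of Wtx.
pose y j := if j == 0%N then x
  else if j == r then rhs E t - \sum_(1 <= i < r) coef E i t * 0 else 0.
have y0 : y 0%N = x by [].
have Ey : satisfies r E t y.
  rewrite /satisfies {1}/y gtn_eqF // eqxx -[RHS](subrK (\sum_(1 <= i < r) coef E i t * 0)).
  congr (_ + _); apply: eq_big_nat => i /andP[i0 ir].
  by rewrite /y gtn_eqF // ltn_eqF.
have [d d0 Hd] := open_ballP (@fiber_open _ P oW t) (Wtx : [set x | W (t, x)] x).
(* Dividing by psi makes the shift e psi equal to d / 2, so that x + e psi remains in the fibre. *)
pose e := d / 2 / psi t.
have e0 : e != 0 by rewrite !mulf_neq0 ?invr_eq0 ?psi0 ?gt_eqF ?pnatr_eq0.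
have We : W (t, y 0%N + e * psi t).
  apply: Hd; rewrite y0 opprD addrA subrr sub0r normrN /e divfK ?psi0 //.
  by rewrite gtr0_norm ?divr_gt0 // ltr_pdivrMr // ltr_pMr // ltr1n.
have D0 z : W (t, z 0%N) -> DT P t z != 0 by move=> Wz; rewrite DT_affine ?T'0.
pose z j := y j + e * psi^`(j)%classic t.
have Ez : satisfies r E t z.
  apply/(PS t z We (D0 z We)); have := (PS t y Wtx (D0 y Wtx)).1 Ey.
  rewrite (PE We).1 (PE (Wtx : W (t, y 0%N))).1 /satisfies => <-.
  rewrite prolong_psi //; congr (_ + _); apply: eq_big_nat => i /andP[i0 _].
  by rewrite prolong_psi.
(* The source equations for z and y differ by e times the homogeneous operator applied to psi. *)
move: Ez; rewrite /satisfies /z -[in RHS]Ey /satisfies /=.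
under [X in _ + X = _ -> _]eq_bigr do rewrite mulrDr mulrCA.
rewrite big_split /= -mulr_sumr addrACA -mulrDr => /eqP.
by rewrite -[X in _ == X]addr0 (inj_eq (addrI _)) mulf_eq0 (negPf e0) => /eqP.
Qed.

(** Any n above k is allowed, the terms with j > k being 0, so that all x^(k) can be expanded over
    one common range. *)
Lemma jet_of_prolong k n t y : (k < n)%N -> W (t, y 0%N) ->
  y k = \sum_(j < n) qcoef k j t * (prolong P j t y - pconst j t).
Proof.
move=> kn Wty; have Bt := base_of Wty.
have trunc (a z : nat -> F) m : (m < n)%N -> (forall i, (m < i)%N -> a i = 0) ->
    \sum_(i < n) a i * z i = \sum_(i < m.+1) a i * z i.
  move=> mn a0; rewrite -!(big_mkord xpredT (fun i => a i * z i)).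
  rewrite (@big_cat_nat _ _ _ m.+1) //= [X in _ + X = _]big_nat_cond.
  rewrite [X in _ + X = _]big1 ?addr0 // => i; rewrite andbT => /andP[mi _].
  by rewrite a0 // mul0r.
transitivity (\sum_(j < n) qcoef k j t * \sum_(i < n) pcoef j i t * y i); last first.
  apply: eq_bigr => j _; rewrite prolong_affine // addrK; congr (_ * _).
  by apply: (trunc (fun i => pcoef j i t)) => // i ji; exact: pcoef_high.
under eq_bigr do rewrite mulr_sumr.
rewrite exchange_big /=.
have sumE (i : nat) :
    \sum_(j < n) qcoef k j t * (pcoef j i t * y i) = (k == i)%:R * y i.
  rewrite -(qcoef_pcoef k i Bt) -(trunc (fun j => qcoef k j t) (fun j => pcoef j i t) k) //.
    by rewrite mulr_suml; apply: eq_bigr => j _; rewrite mulrA.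
  by move=> j kj; exact: qcoef_high.
under eq_bigr do rewrite sumE.
rewrite (bigD1 (Ordinal kn)) //= eqxx mul1r.
rewrite big1 ?addr0 // => i; rewrite eq_sym -[_ == _]/(k == i :> nat) => /negPf ->.
by rewrite mul0r.
Qed.

Variables (r : nat) (E : ode F) (S : F -> F).
Hypothesis r0 : (0 < r)%N.
Hypothesis E_A1 : in_A1 r E.
Hypothesis psiE : solution_on r (homogeneous E) B psi.
Hypothesis dW : suitable_domain W.
Hypothesis oTB : open (T @` B).
Hypothesis ST : forall t, B t -> S (T t) = t.
Hypothesis sS : smooth (T @` B) S.

Let acoef k : F -> F := if k == r then fun=> 1 else coef E k.
(** The coefficient of the new derivative of order j after the new jet is substituted into the
    source operator. *)
Let bcoef j t := \sum_(1 <= k < r.+1) acoef k t * qcoef k j t.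
(** Dividing by [bcoef r] makes the equation monic, composing with S expresses it in the new
    variable, and the constants [pconst] move to the right-hand side. *)
Let target : ode F := Ode (T @` B)
  (fun j => (fun t => bcoef j t / bcoef r t) \o S)
  ((fun t => (rhs E t + \sum_(1 <= j < r.+1) bcoef j t * pconst j t) / bcoef r t) \o S).

Let smooth_acoef k : (0 < k <= r)%N -> smooth B (acoef k).
Proof.
have [BE _ _] := psiE; rewrite /acoef; case: eqP => [_ _|/eqP kr /andP[k0 kler]].
  exact: smooth_cst oB _.
by have [_ sE _] := E_A1; apply: smooth_sub BE _; apply: sE; rewrite k0 ltn_neqAle kr.
Qed.

Let smooth_bcoef j : smooth B (bcoef j).
Proof.
apply: (smooth_sum oB) => k; rewrite mem_index_iota ltnS => kr _.
exact: (smoothM oB (smooth_acoef kr) (@smooth_qcoef k j)).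
Qed.

Let satisfiesE t y : satisfies r E t y <->
  \sum_(1 <= k < r.+1) acoef k t * y k = rhs E t.
Proof.
rewrite big_nat_recr //= /acoef eqxx mul1r addrC /satisfies.
by under [X in _ <-> _ + X = _]eq_big_nat => i /andP[_ ir] do rewrite (ltn_eqF ir).
Qed.

(** By [qcoef0] this coefficient is the homogeneous source operator at psi; its vanishing is what
    puts the target in the first Arnold form. *)
Let bcoef0 t : B t -> bcoef 0 t = 0.
Proof.
move=> Bt; have [_ _ /(_ t Bt)] := psiE; rewrite /satisfies /= /bcoef => H; rewrite -[RHS]H.
rewrite big_nat_recr //= /acoef eqxx mul1r addrC qcoef0; congr (_ + _).
by apply: eq_big_nat => i /andP[_ ir]; rewrite ltn_eqF // qcoef0.
Qed.

Let bcoef_top t : B t -> bcoef r t = psi t * T^`()%classic t ^+ r.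
Proof.
move=> Bt; rewrite /bcoef big_nat_recr //= /acoef eqxx mul1r qcoef_diag //.
rewrite big_nat_cond big1 ?add0r // => i; rewrite andbT => /andP[_ ir].
by rewrite qcoef_high // mulr0.
Qed.

Let bcoef_top_neq0 t : B t -> bcoef r t != 0.
Proof.
by move=> Bt; rewrite bcoef_top // mulf_neq0 ?psi0 // expf_neq0 // T'0.
Qed.

Let sum_acoef t y : W (t, y 0%N) -> \sum_(1 <= k < r.+1) acoef k t * y k =
  \sum_(1 <= j < r.+1) bcoef j t * prolong P j t y
  - \sum_(1 <= j < r.+1) bcoef j t * pconst j t.
Proof.
move=> Wty; have Bt := base_of Wty.
transitivity (\sum_(0 <= j < r.+1) bcoef j t * (prolong P j t y - pconst j t)).
  rewrite big_mkord /bcoef; under [RHS]eq_bigr do rewrite mulr_suml.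
  rewrite exchange_big /=; apply: eq_big_nat => k /andP[_ kr].
  rewrite (jet_of_prolong (n := r.+1) kr Wty) mulr_sumr.
  by apply: eq_bigr => j _; rewrite mulrA.
rewrite big_nat_recl // bcoef0 // mul0r add0r -sumrB big_add1 /=.
by apply: eq_bigr => j _; rewrite mulrBr.
Qed.

Lemma affine_admissible : exists Et : ode F, admissible r E Et P.
Proof.
exists target; split; [exact: E_A1| | |].
- have smap (f : F -> F) : smooth B f -> smooth (T @` B) (f \o S).
    by move=> sf; apply: smooth_comp sf sS => // _ [t Bt <-]; rewrite ST.
  have sbV : smooth B (fun t => (bcoef r t)^-1).
    exact: smoothV oB _ bcoef_top_neq0 (@smooth_bcoef r).
  split; [exact: oTB|move=> i _|]; apply: smap.
    exact: (smoothM oB (@smooth_bcoef i) sbV).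
  apply: (smoothM oB _ sbV); apply: (smoothD oB).
    by have [BE _ _] := psiE; have [_ _ srhs] := E_A1; exact: smooth_sub BE srhs.
  apply: (smooth_sum oB) => j _ _; exact: (smoothM oB (@smooth_bcoef j) (@smooth_pconst j)).
- have aT t x : W (t, x) -> tT P (t, x) = T t + x * 0.
    by move=> /PE[-> _]; rewrite mulr0 addr0.
  have aX t x : W (t, x) -> tX P (t, x) = X0 t + x * (psi t)^-1.
    by move=> /PE[_ ->]; rewrite addrC.
  split=> //.
  + apply: (fiber_affine_smooth2 oW); exists T, (fun=> 0).
    by split; [exact: sT|exact: smooth_cst oB _|exact: aT].
  + apply: (fiber_affine_smooth2 oW); exists X0, (fun t => (psi t)^-1).
    by split; [exact: sX0|exact: smoothV oB _ psi0 spsi|exact: aX].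
  move=> [t x] Wtx; have Bt := base_of Wtx; rewrite /jacobian_det.
  rewrite (fiber_affine_partial_xE oW aT Wtx) (fiber_affine_partial_xE oW aX Wtx).
  have PT t' x' (H : W (t', x')) := (PE H).1.
  by rewrite mul0r subr0 (partial_t_base oW PT Wtx) mulf_neq0 ?invr_eq0 ?psi0 ?T'0.
split=> [[t x] Wtx|t y Wty _].
  have [BE _ _] := psiE; split; first exact/BE/(base_of Wtx).
  by rewrite (PE Wtx).1; exists t => //; exact: base_of Wtx.
have Bt := base_of Wty; have b0 := bcoef_top_neq0 Bt.
rewrite satisfiesE sum_acoef // (PE Wty).1 /satisfies /= ST //.
have -> : prolong P r t y + \sum_(1 <= i < r) bcoef i t / bcoef r t * prolong P i t y =
    (\sum_(1 <= i < r.+1) bcoef i t * prolong P i t y) / bcoef r t.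
  rewrite big_nat_recr //= mulrDl addrC mulr_suml; congr (_ + _).
    by apply: eq_bigr => i _; rewrite mulrAC.
  by rewrite mulrAC mulfV // mul1r.
split=> [<-|]; first by rewrite subrK.
by move=> /(mulIf (invr_neq0 b0)) ->; rewrite addrK.
Qed.

End AffineTransformation.

(** * The three assertions about the groupoid *)

Section Groupoid.
Variable F : numFieldType.
Hypothesis mvi : mean_value_inequality F.

Lemma admissible_of_the_form r (E Et : ode F) (P : transf F) : (3 <= r)%N ->
  admissible r E Et P -> of_the_form r E P.
Proof.
move=> r3 [_ _ ptP PE]; have [[oW _ conW] sT sX _] := ptP.
have [T sT' PT] := smooth2_const_on_fibers oW mvi conW sT (maps_ode_Tx0 ptP r3 PE).
have [X1 [X0 [sX1 sX0 PX PXx]]] :=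
  smooth2_affine_on_fibers oW mvi conW sX (maps_ode_Xxx0 ptP PT r3 PE).
have jac t x (Wtx : tdom P (t, x)) := jacobian_fiber_preserving ptP PT Wtx.
have X10 t : base P t -> X1 t != 0.
  by move=> [x Wtx]; rewrite -(PXx t x Wtx); exact: (jac t x Wtx).2.
have T'0 t : base P t -> T^`() t != 0 by move=> [x /jac[]].
have oB := base_open oW.
(* The function psi is 1 / X_x, where X_x is nonzero by the Jacobian condition. *)
have spsi := smoothV oB X10 sX1.
have psi0 t : base P t -> (X1 t)^-1 != 0 by move=> Bt; rewrite invr_eq0 X10.
have PTX t x : tdom P (t, x) -> tT P (t, x) = T t /\ tX P (t, x) = x / (X1 t)^-1 + X0 t.
  by move=> Wtx; rewrite invrK PX ?PT.
exists T, X0, (fun t => (X1 t)^-1); split=> //.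
exact: (maps_ode_psi oW sT' sX0 spsi T'0 psi0 PTX (ltnW (ltnW r3)) PE).
Qed.

Hypothesis nam : norm_attains_min F.

(** T need not be injective on the whole base, while the target coefficients are composed with an
    inverse of T; hence the restriction to a neighbourhood U of t0. *)
Lemma of_the_form_admissible r (E : ode F) (P : transf F) t0 : (0 < r)%N ->
  in_A1 r E -> suitable_domain (tdom P) -> of_the_form r E P -> base P t0 ->
  exists (U : set F) (Et : ode F),
    [/\ open U, U t0 & admissible r E Et (restrict_base P U)].
Proof.
move=> r0 E1 [oW _ conW] [T [X0 [psi [[sT sX0] T'0 psiE psi0 PTX]]]] Bt0.
have [U [S [[oU Ut0 UB] oTU ST sS]]] :=
  local_inverse mvi nam (base_open oW) sT Bt0 (T'0 t0 Bt0).
pose Q := restrict_base P U.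
have BQ : base Q = U.
  apply/seteqP; split=> [t [x [_ /=]]//|t Ut].
  by have [x Wtx] := UB t Ut; exists x.
have QB : base Q `<=` base P by rewrite BQ.
have dQ : suitable_domain (tdom Q).
  split.
  - apply: openI oW _; rewrite openE => -[t x] /= Ut.
    have := differentiable_continuous (fst_differentiable (t, x)).
    by apply; exact: open_nbhs_nbhs.
  - by have [x Wtx] := Bt0; exists (t0, x).
  - move=> t; have [Ut|nUt] := pselect (U t).
      suff -> : [set x | tdom Q (t, x)] = [set x | tdom P (t, x)] by exact: conW.
      by apply/seteqP; split=> [x []|x Wtx]//; split.
    suff -> : [set x | tdom Q (t, x)] = set0 by exact: connected0.
    by apply/seteqP; split=> x // -[_ /= /nUt].
have psiQ : solution_on r (homogeneous E) (base Q) psi.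
  have [BE spsi Hpsi] := psiE; split=> [t /QB/BE//||t /QB/Hpsi//].
  exact: smooth_sub QB spsi.
have [oQ _ _] := dQ; have [_ spsi _] := psiQ.
have [||||||Et adm] := @affine_admissible F Q T X0 psi oQ
  (smooth_sub QB sT) (smooth_sub QB sX0) spsi _ _ _ r E S r0 E1 psiQ dQ.
- by move=> t /QB; exact: T'0.
- by move=> t /QB; exact: psi0.
- by move=> t x [Wtx _]; exact: PTX.
- by rewrite BQ.
- by rewrite BQ.
- by rewrite BQ.
by exists U, Et.
Qed.

(** The constant 1 solves the homogeneous equation because there is no term of order 0, so the
    identity has the stated form with psi = 1 and X0 = 0. As T is the identity, no shrinking of the
    domain is required. *)
Lemma identity_admissible r (E : ode F) : (0 < r)%N -> in_A1 r E -> dom E !=set0 ->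
  exists (Et : ode F) (P : transf F), admissible r E Et P /\ base P = dom E.
Proof.
move=> r0 E1 [t0 Et0]; have [oE _ _] := E1.
pose P := Transf [set p | dom E p.1] fst snd.
have BP : base P = dom E.
  by apply/seteqP; split=> [t []//|t Et]; exists 0.
have id' : (id : F -> F)^`() = cst 1.
  by apply/funext => t; exact: is_derive_derive1 (is_derive_id _ _).
have oW : open (tdom P).
  rewrite openE => -[t x] /= Et.
  have := differentiable_continuous (fst_differentiable (t, x)).
  by apply; exact: open_nbhs_nbhs.
have dW : suitable_domain (tdom P).
  split=> //; first by exists (t0, 0).
  move=> t; have [Et|nEt] := pselect (dom E t).
    suff -> : [set x | tdom P (t, x)] = setT by exact: connectedT mvi.
    by apply/seteqP; split.
  suff -> : [set x | tdom P (t, x)] = set0 by exact: connected0.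
  by apply/seteqP; split=> x.
have derive1n_cst k : (fun=> 1 : F)^`(k.+1) = fun=> 0.
  elim: k => [|k IH]; first by apply/funext => t; rewrite derive1n1 derive1_cst.
  by rewrite derive1nS IH; apply/funext => t; rewrite derive1_cst.
have psiE : solution_on r (homogeneous E) (base P) (fun=> 1).
  split=> [|| t _]; [by rewrite BP|by rewrite BP; exact: smooth_cst oE _|].
  rewrite /satisfies /= -(prednK r0) derive1n_cst add0r big_nat_cond big1 // => i.
  by rewrite andbT => /andP[i0 _]; rewrite -(prednK i0) derive1n_cst mulr0.
have [|||||||||Et adm] := @affine_admissible F P id (fun=> 0) (fun=> 1) oW
  _ _ _ _ _ _ r E id r0 E1 psiE dW.
- by rewrite BP; exact: smooth_id oE.
- by rewrite BP; exact: smooth_cst oE _.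
- by rewrite BP; exact: smooth_cst oE _.
- by move=> t _; rewrite id' oner_neq0.
- by move=> t _; rewrite oner_neq0.
- by move=> t x _; rewrite divr1 addr0.
- by rewrite image_id BP.
- by [].
- by rewrite image_id BP; exact: smooth_id oE.
by exists Et, P.
Qed.

End Groupoid.

Theorem proposition15 (R : realType) (F : numFieldType)
    (hF : F = (R : numFieldType) \/ F = (R[i] : numFieldType))
    (r : nat) (hr : (3 <= r)%N) :
  (* the transformational parts have the stated form *)
  (forall (E Et : ode F) (P : transf F),
     admissible r E Et P -> of_the_form r E P) /\
  (* every transformation of the stated form is, locally in t, admissible *)
  (forall (E : ode F) (P : transf F),
     in_A1 r E -> suitable_domain (tdom P) -> of_the_form r E P ->
     forall t0 : F, base P t0 ->
     exists (U : set F) (Et : ode F),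
       [/\ open U, U t0 & admissible r E Et (restrict_base P U)]) /\
  (* the equation-sources exhaust the class *)
  (forall E : ode F, in_A1 r E -> dom E !=set0 ->
     exists (Et : ode F) (P : transf F),
       admissible r E Et P /\ base P = dom E).
Proof.
have [mvi nam] : mean_value_inequality F /\ norm_attains_min F.
  case: hF => ->; split.
  - exact: real_mean_value_inequality.
  - exact: real_norm_attains_min.
  - exact: complex_mean_value_inequality.
  - exact: complex_norm_attains_min.
have r0 : (0 < r)%N by exact: leq_trans hr.
split; [|split].
- by move=> E Et P; exact: admissible_of_the_form.
- move=> E P E1 dP fP t0 Bt0; exact: of_the_form_admissible E1 dP fP Bt0.
- by move=> E E1 E0; exact: identity_admissible.
Qed.
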